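(* Fix $p \geq 2$, $K\ge 1$, a proportion vector $\boldsymbol\lambda=(\lambda_1,\ldots,\lambda_K)$ and a symmetric probability tensor $\boldsymbol\Theta=((\theta_{j_1\ldots j_p}))_{1\le j_1,\ldots,j_p\le K}$ with entries in $[0,1]$. For each $N$ let $G_N \sim \mathcal{H}_{p, K, N}(\boldsymbol \lambda, \boldsymbol \Theta)$ be a hypergraph stochastic block model on $N$ vertices with adjacency tensor $\boldsymbol A_{G_N}$, and consider the $p$-tensor Ising model $\mathbb{P}_\beta$ with interaction tensor $\boldsymbol J_N= \frac{1}{N^{p-1}} \boldsymbol A_{G_N}$. Then, for almost every realization of the sequence $(G_N)_{N\ge1}$, given a sample $\boldsymbol X\sim\mathbb{P}_\beta$, the following hold: (1) The maximum pseudo-likelihood (MPL) estimate $\hat{\beta}_N(\boldsymbol X)$ is $\sqrt{N}$-consistent for $\beta > \beta_{\mathrm{HSBM}}^*$. (2) There does not exist any consistent sequence of estimators for any $\beta < \beta_{\mathrm{HSBM}}^*$.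
   Context: Hypergraph stochastic block model $\mathcal{H}_{p,K,N}(\boldsymbol\lambda,\boldsymbol\Theta)$: $\boldsymbol\lambda=(\lambda_1,\ldots,\lambda_K)$ is a vector of community proportions (nonnegative, $\sum_j\lambda_j=1$) and $\boldsymbol\Theta$ is symmetric under index permutations. Let $\mathcal{B}_j=(N\sum_{i=1}^{j-1}\lambda_i,\,N\sum_{i=1}^{j}\lambda_i]\cap\{1,\ldots,N\}$. The random $p$-uniform hypergraph $G_N$ on $\{1,\ldots,N\}$ has adjacency tensor $\boldsymbol A_{G_N}=((a_{i_1\ldots i_p}))$, where for $i_1<\cdots<i_p$ the entries $a_{i_1\ldots i_p}$ are independent with $a_{i_1\ldots i_p}\sim\mathrm{Ber}(\theta_{j_1\ldots j_p})$ if $(i_1,\ldots,i_p)\in\mathcal{B}_{j_1}\times\cdots\times\mathcal{B}_{j_p}$; the tensor is extended symmetrically, and entries with two coinciding indices are zero. The threshold is $$\beta_{\mathrm{HSBM}}^*=\sup\Big\{\beta\geq0:\sup_{(t_1,\ldots,t_K)\in[0,1]^K}\phi_\beta(t_1,\ldots,t_K)=0\Big\},$$ $$\phi_\beta(t_1,\ldots,t_K)=\beta\sum_{1\leq j_1,\ldots,j_p\leq K}\theta_{j_1\ldots j_p}\prod_{\ell=1}^p\lambda_{j_\ell}t_{j_\ell}-\sum_{j=1}^K\lambda_jI(t_j),$$ with $I(t)=\frac12\{(1+t)\log(1+t)+(1-t)\log(1-t)\}$ for $t\in[-1,1]$ ($0\log 0=0$). The $p$-tensor Ising model with interaction tensor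 $\boldsymbol J_N$ and parameter $\beta\ge0$ is the distribution on $\{-1,1\}^N$ given by $\mathbb{P}_{\beta}(\boldsymbol x)=\frac{1}{2^NZ_N(\beta)}e^{\beta H_N(\boldsymbol x)}$, with $H_N(\boldsymbol x)=\sum_{1\leq i_1,\ldots,i_p\leq N}J_{i_1\ldots i_p}x_{i_1}\cdots x_{i_p}$ and $Z_N(\beta)=2^{-N}\sum_{\boldsymbol x\in\{-1,1\}^N}e^{\beta H_N(\boldsymbol x)}$. With $m_i(\boldsymbol x)=\sum_{1\leq i_2,\ldots,i_p\leq N}J_{ii_2\ldots i_p}x_{i_2}\cdots x_{i_p}$, the MPL estimate is $\hat\beta_N(\boldsymbol X)=\inf\{b\geq0:H_N(\boldsymbol X)=\sum_{i=1}^Nm_i(\boldsymbol X)\tanh(p\,b\,m_i(\boldsymbol X))\}$, with $\inf\emptyset=+\infty$. A sequence of estimators $\hat\beta_N=\hat\beta_N(\boldsymbol X)$ (based on the single sample $\boldsymbol X$) is consistent at $\beta$ if $\hat\beta_N(\boldsymbol X)\to\beta$ in probability under $\mathbb{P}_\beta$ as $N\to\infty$. It is $\sqrt N$-consistent at $\beta$ if for every $\delta>0$ there is $M=M(\delta,\beta)>0$ with $\mathbb{P}_\beta(\sqrt N|\hat\beta_N(\boldsymbol X)-\beta|\le M)>1-\delta$ for all $N$ large enough.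
   Formalization: In (2), since the constant estimator equal to β is trivially consistent at that single β, the claim is read as: for any two distinct parameters β, β' in [0, β*_HSBM), no sequence of estimators is consistent at both. *)

(* Defs.v *)
From HB Require Import structures.
From mathcomp Require Import all_boot all_order all_algebra.
From mathcomp Require Import all_classical all_reals all_analysis.

Set Implicit Arguments.
Unset Strict Implicit.
Unset Printing Implicit Defensive.

Import Order.TTheory GRing.Theory Num.Theory.
Import numFieldTopology.Exports numFieldNormedType.Exports.

Local Open Scope classical_set_scope.
Local Open Scope ring_scope.

(** Order-[p] tensors over [{1, ..., n}]; the vertex [k] of the mathematical
    text is the ordinal of value [k - 1]. *)
Definition tensor (p n : nat) (R : Type) := p.-tuple 'I_n -> R.

Definition symmetric_tensor (p n : nat) (R : Type) (J : tensor p n R) : Prop :=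
  forall s t : p.-tuple 'I_n, perm_eq s t -> J s = J t.

Section TensorIsing.
Context {R : realType}.

Definition config (N : nat) := {ffun 'I_N -> bool}.

Definition spin N (x : config N) (i : 'I_N) : R := if x i then 1 else -1.

Section FixedSize.
Variables (p N : nat) (J : tensor p N R).

Definition hamiltonian (x : config N) : R :=
  \sum_(t : p.-tuple 'I_N) J t * \prod_(k <- t) spin x k.

Definition partition_fun (beta : R) : R :=
  2 ^- N * \sum_(x : config N) expR (beta * hamiltonian x).

Definition ising_pmf (beta : R) (x : config N) : R :=
  expR (beta * hamiltonian x) / (2 ^+ N * partition_fun beta).

Definition ising_prob (beta : R) (A : {set config N}) : R :=
  \sum_(x in A) ising_pmf beta x.

Definition local_field (x : config N) (i : 'I_N) : R :=
  \sum_(t : p.-tuple 'I_N | ohead t == Some i)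
    J t * \prod_(k <- behead t) spin x k.

Definition tanh (u : R) : R :=
  (expR u - expR (- u)) / (expR u + expR (- u)).

(** [ereal_inf set0 = +oo], as required when the equation has no solution. *)
Definition mpl (x : config N) : \bar R :=
  ereal_inf [set b%:E | b in [set b : R | 0 <= b /\
    hamiltonian x = \sum_(i < N)
      local_field x i * tanh (p%:R * b * local_field x i)]].

End FixedSize.

(** Estimators are allowed the value [+oo], which [mpl] may take. *)
Definition estimator_seq := forall N : nat, config N -> \bar R.

Definition consistent p (J : forall N, tensor p N R) (est : estimator_seq)
    (beta : R) : Prop :=
  forall eps : R, 0 < eps ->
    (fun N => ising_prob (J N) beta
       [set x : config N | (eps%:E < `|est N x - beta%:E|)%E]%SET)
      @ \oo --> (0 : R).

Definition sqrt_consistent p (J : forall N, tensor p N R)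
    (est : estimator_seq) (beta : R) : Prop :=
  forall delta : R, 0 < delta -> exists2 M : R, 0 < M &
    \forall N \near \oo,
      1 - delta < ising_prob (J N) beta
        [set x : config N |
          ((Num.sqrt N%:R)%:E * `|est N x - beta%:E| <= M%:E)%E]%SET.

End TensorIsing.
Arguments estimator_seq : clear implicits.

Section Hypergraph.

Definition hypergraph (p N : nat) :=
  {E : {set {set 'I_N}} | [forall e in E, #|e| == p]}.

Definition adjacency p N (G : hypergraph p N) : tensor p N bool :=
  fun t => uniq t && ([set k in (t : seq 'I_N)]%SET \in sval G).

(** The interaction tensor [N^-(p-1) A_G]. *)
Definition scaled_adjacency (R : realType) p N (G : hypergraph p N) :
    tensor p N R :=
  fun t => (adjacency G t)%:R / N%:R ^+ p.-1.

End Hypergraph.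

Section HSBM.
Context {R : realType}.

Definition proportion_vector K (lambda : 'I_K -> R) : Prop :=
  (forall j, 0 <= lambda j) /\ \sum_(j < K) lambda j = 1.

Definition block K (lambda : 'I_K -> R) N (j : 'I_K) : {set 'I_N} :=
  [set v : 'I_N |
    N%:R * (\sum_(k < K | (k < j)%N) lambda k) < (v.+1)%:R
      <= N%:R * (\sum_(k < K | (k <= j)%N) lambda k)]%SET.

(** Mutual independence of a finite family of random variables; taking some
    of the [B i] to be [setT] yields the product rule for every subfamily. *)
Definition mutually_independent d d' (Omega : measurableType d)
    (T : measurableType d') (P : probability Omega R) (I : finType)
    (X : I -> Omega -> T) : Prop :=
  forall B : I -> set T, (forall i, measurable (B i)) ->
    P (\bigcap_(i in [set: I]) (X i @^-1` B i)) =
    (\prod_(i : I) fine (P (X i @^-1` B i)))%:E.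

Definition increasing_tuple (p N : nat) :=
  {t : p.-tuple 'I_N | sorted ltn [seq val k | k <- t]}.

Record is_HSBM d (Omega : measurableType d) (P : probability Omega R)
    (p K N : nat) (lambda : 'I_K -> R) (Theta : tensor p K R)
    (G : Omega -> hypergraph p N) : Prop := IsHSBM {
  hsbm_measurable : forall t : increasing_tuple p N,
    measurable_fun setT (fun w => adjacency (G w) (sval t)) ;
  hsbm_law : forall (t : increasing_tuple p N) (j : p.-tuple 'I_K),
    (forall l : 'I_p, tnth (sval t) l \in block lambda N (tnth j l)) ->
    forall B : set bool,
      P ((fun w => adjacency (G w) (sval t)) @^-1` B) =
      bernoulli_prob (Theta j) B ;
  hsbm_independent :
    mutually_independent P
      (fun (t : increasing_tuple p N) w => adjacency (G w) (sval t))
}.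

(** [ln] vanishes on nonpositive reals, hence [0 log 0 = 0]. *)
Definition rate_fun (t : R) : R :=
  2^-1 * ((1 + t) * ln (1 + t) + (1 - t) * ln (1 - t)).

Definition hsbm_phi p K (lambda : 'I_K -> R) (Theta : tensor p K R)
    (beta : R) (t : 'I_K -> R) : R :=
  beta * (\sum_(j : p.-tuple 'I_K) Theta j * \prod_(k <- j) (lambda k * t k))
  - \sum_(k < K) lambda k * rate_fun (t k).

(** Possibly [+oo], e.g. when [Theta] is zero. *)
Definition hsbm_threshold p K (lambda : 'I_K -> R) (Theta : tensor p K R) :
    \bar R :=
  ereal_sup [set beta%:E | beta in [set beta : R | 0 <= beta /\
    ereal_sup [set (hsbm_phi lambda Theta beta t)%:E |
                t in [set t : 'I_K -> R | forall k, 0 <= t k <= 1]] = 0%E]].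

End HSBM.

(* Main.v *)
Require Import Defs.
From HB Require Import structures.
From mathcomp Require Import all_boot all_order all_algebra.
From mathcomp Require Import all_classical all_reals all_analysis.
From mathcomp Require Import perm ring lra zify.

Set Implicit Arguments.
Unset Strict Implicit.
Unset Printing Implicit Defensive.

Import Order.TTheory GRing.Theory Num.Theory.
Import numFieldTopology.Exports numFieldNormedType.Exports.

Local Open Scope classical_set_scope.
Local Open Scope ring_scope.

(** Write [H = U + W], where [U] is the Hamiltonian of the mean interaction given the
    blocks and [W] is the fluctuation due to the random edges. All means below are over
    uniform configurations, so that the partition function is the mean of
    [expR (beta * H)].

    The mean-field part [U] is, up to a bounded error, [N] times a polynomial in the
    block magnetizations ([mean_tensor_energy]), and [hsbm_phi] is what a Laplace
    principle associates with it. Above the threshold some [t] makes [hsbm_phi]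
    positive, and Gibbs' variational principle shows that the mean of [expR (beta * U)]
    grows exponentially ([mean_field_lower]). Below it, [beta * U] is bounded by a
    fraction [rho < 1] of the large-deviation rate of the magnetizations, whose
    exponential moment of order [rho] is bounded uniformly in [N]
    ([mean_exp_rate_le]); hence the means of [expR (beta * U)] and
    [expR (- beta * U)] stay bounded ([mean_field_bounded]).

    The fluctuation is harmless: almost surely, for every real [c], the mean of
    [expR (c * W)] stays bounded ([fluctuation_ae]). Its moments of order [k], with [k]
    logarithmic in [N], are controlled by the overlaps of [k] replicas
    ([noise_moment]), and Borel-Cantelli applies. Young's inequality then transfers
    both the growth and the boundedness from [U] to [H], at the price of an arbitrarily
    small change of [beta] ([exp_mean_growth], [exp_mean_perturb]). From here on the
    hypergraph is fixed.

    Above the threshold the partition function grows exponentially, so that typically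
    [H] is at least a constant times [N] and the squared local fields sum to order [N].
    This is the curvature of the pseudo-likelihood, whose score at the true parameter
    is [O(sqrt N)] by an exchangeable-pair computation ([pseudo_score_sqr_mean]). The
    root of the score is therefore within [O(1 / sqrt N)] of the parameter
    ([mpl_close]).

    Below the threshold the means of [expR (beta * H)] and [expR (- beta * H)] stay
    bounded, so that the laws at two such parameters are contiguous: an event that is
    asymptotically negligible under one is so under the other ([transfer_cvg0]). No
    estimator can then converge to both parameters. *)

(** * Elementary inequalities *)

Section Elementary.
Context {R : realType}.
Implicit Types (u v x y t theta : R).

(** From [expR y * (1 - y) <= 1], the bound reduces to the polynomial inequality
    [1 <= (1 - y) (1 + y + 2 y^2)]. *)
Lemma expR_le_quad y : y <= 2^-1 -> expR y <= 1 + y + 2 * y ^+ 2.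
Proof.
move=> y2.
have H := expR_ge1Dx (- y).
have e0 := expR_gt0 y.
have : expR y * (1 - y) <= 1.
  by rewrite -[leRHS](expRxMexpNx_1 y) ler_wpM2l// ltW.
move=> H1.
have : 1 <= (1 + y + 2 * y ^+ 2) * (1 - y).
  have : 0 <= y ^+ 2 * (1 - 2 * y) by rewrite mulr_ge0 ?sqr_ge0//; lra.
  by nra.
move=> H2; have : 0 < 1 - y by lra.
move=> y1; rewrite -(ler_pM2r y1); lra.
Qed.

(** Sub-Gaussian bound for a centred Bernoulli variable: the linear terms of
    [expR_le_quad] average to zero, which leaves the quadratic one. *)
Lemma bernoulli_mgf_le theta v : 0 <= theta <= 1 -> `|v| <= 2^-1 ->
  theta * expR (v * (1 - theta)) + (1 - theta) * expR (v * (0 - theta))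
    <= expR (2 * v ^+ 2).
Proof.
move=> /andP[t0 t1]; rewrite ler_norml => /andP[v1 v2].
apply: le_trans (expR_ge1Dx _).
have H1 := @expR_le_quad (v * (1 - theta)).
have H2 := @expR_le_quad (v * (0 - theta)).
apply: (@le_trans _ _ (theta * (1 + (v * (1 - theta)) + 2 * (v * (1 - theta)) ^+ 2)
  + (1 - theta) * (1 + (v * (0 - theta)) + 2 * (v * (0 - theta)) ^+ 2))).
  apply: lerD; apply: ler_wpM2l; rewrite ?subr_ge0//.
    by apply: H1; nra.
  by apply: H2; nra.
have -> : theta * (1 + (v * (1 - theta)) + 2 * (v * (1 - theta)) ^+ 2)
  + (1 - theta) * (1 + (v * (0 - theta)) + 2 * (v * (0 - theta)) ^+ 2)
  = 1 + 2 * (v ^+ 2 * (theta * (1 - theta))) by ring.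
rewrite lerD2l ler_wpM2l// ler_piMr ?sqr_ge0//; nra.
Qed.

Lemma rate_funN t : rate_fun (- t) = rate_fun t.
Proof. by rewrite /rate_fun opprK addrC. Qed.

Lemma rate_fun_norm t : rate_fun `|t| = rate_fun t.
Proof. by case: (ger0P t) => // _; rewrite rate_funN. Qed.

Lemma mul_ln_le x : 0 <= x -> x * ln x <= x * (x - 1).
Proof.
rewrite le_eqVlt => /orP[/eqP<-|x0]; first by rewrite !mul0r.
apply: ler_wpM2l; first exact: ltW.
by rewrite -{1}(subrK 1 x) addrC le_ln1Dx//; lra.
Qed.

Lemma rate_fun_le_sqr t : `|t| <= 1 -> rate_fun t <= t ^+ 2.
Proof.
rewrite ler_norml => /andP[t0 t1]; rewrite /rate_fun.
have H1 := @mul_ln_le (1 + t); have H2 := @mul_ln_le (1 - t).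
have {}H1 := H1 ltac:(lra); have {}H2 := H2 ltac:(lra).
lra.
Qed.

(** The tangent-line bound [ln z <= z - 1] at [z = y / x], multiplied by [x] so that
    it survives at [x = 0]. *)
Lemma mul_ln_ge x y : 0 <= x -> 0 < y -> x * ln y - (y - x) <= x * ln x.
Proof.
rewrite le_eqVlt => /orP[/eqP<-|x0] y0.
  by rewrite !mul0r subr0 sub0r oppr_le0 ltW.
have := @le_ln1Dx R (y / x - 1).
rewrite [1 + _]addrC subrK lnM ?posrE ?invr_gt0// lnV ?posrE//.
have -> : -1 < y / x - 1 by have := divr_gt0 y0 x0; lra.
move=> /(_ isT) /(ler_wpM2l (ltW x0)).
have -> : x * (y / x - 1) = y - x by field; rewrite gt_eqF.
by rewrite mulrDr mulrN; lra.
Qed.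

(** Gibbs' variational inequality: comparing the two-point law of mean [t] with the
    tilt of parameter [h] gives [rate_fun t >= t h - ln (cosh h)]. The choice
    [h = t / 4] keeps [h] in the range of [expR_le_quad], which bounds [cosh h]. Any
    positive quadratic constant would do in place of [1 / 8]. *)
Lemma rate_fun_ge_sqr t : `|t| <= 1 -> t ^+ 2 / 8 <= rate_fun t.
Proof.
rewrite ler_norml => /andP[t0 t1]; rewrite /rate_fun.
pose h := t / 4; pose c := (expR h + expR (- h)) / 2.
have c0 : 0 < c by rewrite divr_gt0// addr_gt0// expR_gt0.
have y1 : 0 < expR h / c by rewrite divr_gt0// expR_gt0.
have y2 : 0 < expR (- h) / c by rewrite divr_gt0// expR_gt0.
have H1 := @mul_ln_ge (1 + t) _ ltac:(lra) y1.
have H2 := @mul_ln_ge (1 - t) _ ltac:(lra) y2.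
rewrite !lnM ?posrE ?expR_gt0 ?invr_gt0// !expRK lnV ?posrE// in H1 H2.
have H3 : ln c <= 2 * h ^+ 2.
  have cE : c <= 1 + 2 * h ^+ 2.
    rewrite /c ler_pdivrMr//.
    have e1 := @expR_le_quad h ltac:(rewrite /h; lra).
    have e2 := @expR_le_quad (- h) ltac:(rewrite /h; lra).
    by rewrite sqrrN in e2; lra.
  apply: (@le_trans _ _ (ln (1 + 2 * h ^+ 2))).
    by rewrite ler_ln ?posrE//; apply: lt_le_trans cE.
  by apply: le_ln1Dx; have := sqr_ge0 h; lra.
have H4 : expR h / c + expR (- h) / c = 2.
  have e2c : expR h + expR (- h) = 2 * c by rewrite /c; field.
  by rewrite -mulrDl e2c mulfK// gt_eqF.
have ht : t * h = t ^+ 2 / 4 by rewrite /h; ring.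
have hh : h ^+ 2 = t ^+ 2 / 16 by rewrite /h; field.
rewrite hh in H3.
have : (1 + t) * (h + - ln c) + (1 - t) * (- h + - ln c) = 2 * (t * h) - 2 * ln c.
  by ring.
lra.
Qed.

Lemma rate_fun_ge0 t : `|t| <= 1 -> 0 <= rate_fun t.
Proof.
move=> /rate_fun_ge_sqr; apply: le_trans; rewrite divr_ge0// sqr_ge0//.
Qed.

Lemma rate_fun_le1 t : `|t| <= 1 -> rate_fun t <= 1.
Proof.
move=> t1; apply: le_trans (rate_fun_le_sqr t1) _.
by rewrite -real_normK ?num_real// expr_le1.
Qed.

(** The exponential lies above its tangent line at the mean. *)
Lemma expR_jensen (I : finType) (a y : I -> R) :
  (forall i, 0 <= a i) -> \sum_i a i = 1 ->
  expR (\sum_i a i * y i) <= \sum_i a i * expR (y i).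
Proof.
move=> a0 a1; set m := \sum_i a i * y i.
have -> : expR m = \sum_i a i * (expR m * (1 + (y i - m))).
  under eq_bigr do rewrite mulrCA mulrDr mulr1 mulrBr.
  rewrite -mulr_sumr big_split/= sumrB -mulr_suml a1 mul1r -/m subrr addr0.
  by rewrite mulr1.
apply: ler_sum => i _; apply: ler_wpM2l => //.
have -> : expR (y i) = expR m * expR (y i - m) by rewrite -expRD addrC subrK.
by rewrite ler_wpM2l ?expR_ge0// expR_ge1Dx.
Qed.

Lemma expR_young (a u v : R) : 0 <= a <= 1 ->
  expR (a * u + (1 - a) * v) <= a * expR u + (1 - a) * expR v.
Proof.
move=> /andP[a0 a1].
have := @expR_jensen bool (fun b => if b then a else 1 - a) (fun b => if b then u else v).
rewrite !big_bool/=; apply; last by rewrite addrC subrK.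
by case => //; rewrite subr_ge0.
Qed.

End Elementary.

(** * Exponential moments of the block magnetizations *)

Section UniformMean.
Context {R : realType}.

(** Expectation under the uniform law on configurations; the partition function is
    [unif_mean] of the Boltzmann weight by definition. *)
Definition unif_mean N (F : config N -> R) : R := 2 ^- N * \sum_(x : config N) F x.

Lemma unif_mean_le N (F G : config N -> R) : (forall x, F x <= G x) ->
  unif_mean F <= unif_mean G.
Proof.
by move=> FG; rewrite ler_wpM2l ?invr_ge0 ?exprn_ge0//; apply: ler_sum.
Qed.

Lemma unif_mean_ge0 N (F : config N -> R) : (forall x, 0 <= F x) ->
  0 <= unif_mean F.
Proof. by move=> F0; rewrite mulr_ge0 ?invr_ge0 ?exprn_ge0//; apply: sumr_ge0. Qed.

Lemma unif_mean_sum N (I : finType) (F : I -> config N -> R) :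
  unif_mean (fun x => \sum_i F i x) = \sum_i unif_mean (F i).
Proof. by rewrite /unif_mean exchange_big/= mulr_sumr. Qed.

Lemma unif_meanZ N c (F : config N -> R) :
  unif_mean (fun x => c * F x) = c * unif_mean F.
Proof. by rewrite /unif_mean -mulr_sumr mulrCA. Qed.

Lemma unif_meanD N (F G : config N -> R) :
  unif_mean (fun x => F x + G x) = unif_mean F + unif_mean G.
Proof. by rewrite /unif_mean big_split mulrDr. Qed.

Lemma unif_mean_prod N (g : 'I_N -> bool -> R) :
  unif_mean (fun x => \prod_i g i (x i)) = \prod_i ((g i true + g i false) / 2).
Proof.
rewrite /unif_mean -(bigA_distr_bigA g) big_split/= prodr_const card_ord exprVn.
by rewrite mulrC; congr (_ * _); apply: eq_bigr => i _; rewrite big_bool.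
Qed.

Lemma unif_mean_cst N (c : R) : unif_mean (fun _ : config N => c) = c.
Proof.
rewrite /unif_mean sumr_const card_ffun card_bool card_ord -[c *+ _]mulr_natr.
by rewrite natrX mulrC mulfK// expf_neq0.
Qed.

(** [fun x => \prod_i (1 + c i * spin x i)] is thus the density of a product measure
    with means [c i], when these lie in [[-1, 1]]. *)
Lemma unif_mean_tilt N (c : 'I_N -> R) :
  unif_mean (fun x => \prod_i (1 + c i * spin x i)) = 1.
Proof.
rewrite (unif_mean_prod (fun i b => 1 + c i * (if b then 1 else -1))).
by rewrite big1// => i _; lra.
Qed.

Lemma spin_sqr N (x : config N) i : spin x i * spin x i = 1 :> R.
Proof. by rewrite /spin; case: ifP => _; lra. Qed.

Lemma norm_spin N (x : config N) i : `|spin x i| = 1 :> R.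
Proof. by rewrite /spin; case: ifP => _; rewrite ?normrN normr1. Qed.

End UniformMean.

Section Mixture.
Context {R : realType}.
Implicit Types (L rho u : R).

Lemma expR_rate_count (a b n : nat) : (a + b = n)%N -> (0 < n)%N -> (b <= a)%N ->
  let u : R := (a%:R - b%:R) / n%:R in
  expR (n%:R * rate_fun u) = (1 + u) ^+ a * (1 - u) ^+ b.
Proof.
move=> abn n0 ba u; have nR : 0 < n%:R :> R by rewrite ltr0n.
have nE : n%:R = a%:R + b%:R :> R by rewrite -natrD abn.
have u1 : n%:R * (1 + u) = 2 * a%:R.
  by rewrite /u mulrDr mulrC mul1r mulrCA mulfV ?gt_eqF// nE; lra.
have u2 : n%:R * (1 - u) = 2 * b%:R.
  by rewrite /u mulrBr mulrC mul1r mulrCA mulfV ?gt_eqF// nE; lra.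
have -> : n%:R * rate_fun u = a%:R * ln (1 + u) + b%:R * ln (1 - u).
  by rewrite /rate_fun; transitivity
   (2^-1 * ((n%:R * (1 + u)) * ln (1 + u) + (n%:R * (1 - u)) * ln (1 - u)));
   [ring | rewrite u1 u2; field].
rewrite expRD !expRM_natl lnK; last first.
  rewrite posrE -(pmulr_rgt0 _ nR) u1 mulr_gt0// ltr0n; lia.
case: (posnP b) => [->|b0]; first by rewrite !expr0.
by rewrite lnK// posrE -(pmulr_rgt0 _ nR) u2 mulr_gt0// ltr0n.
Qed.

(** A large-deviation event of level [L] is covered by two product densities, one
    for each sign of the magnetization. The mean [u] is the smallest attained
    magnetization whose rate reaches [L]: at that magnetization the density equals
    [expR (n * rate_fun u)], and it only grows with the number of plus spins. *)
Lemma tilt_level (n : nat) L : exists u : R, 0 <= u <= 1 /\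
  forall a b, (a + b = n)%N -> L <= n%:R * rate_fun ((a%:R - b%:R) / n%:R) ->
  expR L <= (1 + u) ^+ a * (1 - u) ^+ b + (1 - u) ^+ a * (1 + u) ^+ b.
Proof.
pose Q a := [&& (a <= n)%N, (n - a <= a)%N &
  L <= n%:R * rate_fun ((a%:R - (n - a)%:R) / n%:R)].
have QP a b : (a + b = n)%N -> L <= n%:R * rate_fun ((a%:R - b%:R) / n%:R) ->
    (b <= a)%N -> Q a.
  move=> abn Lab ba; have bE : (n - a = b)%N by lia.
  by rewrite /Q bE Lab ba; apply/and3P; split => //; lia.
have swap a b : rate_fun ((b%:R - a%:R) / n%:R) = rate_fun ((a%:R - b%:R) / n%:R) :> R.
  by rewrite -rate_funN -mulNr opprB.
case: (posnP n) => [n0|n0].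
  exists 0; split; first by rewrite lexx ler01.
  move=> a b abn; rewrite n0 mul0r => L0.
  have -> : a = 0%N by lia.
  have -> : b = 0%N by lia.
  rewrite !expr0 mulr1; apply: (@le_trans _ _ (1 : R)); last by lra.
  by rewrite -(expR0 R) ler_expR.
have nR : 0 < n%:R :> R by rewrite ltr0n.
case: (pselect (exists a, Q a)) => [exQ|nexQ]; last first.
  exists 0; split; first by rewrite lexx ler01.
  move=> a b abn Lab; exfalso; apply: nexQ.
  case: (leqP b a) => [ba|/ltnW ab]; first by exists a; apply: (QP a b).
  by exists b; apply: (QP b a) => //; [lia|rewrite swap].
case: (ex_minnP exQ) => a0 /and3P[a0n ba0 La0] mina0.
pose u : R := (a0%:R - (n - a0)%:R) / n%:R.
have u0 : 0 <= u by rewrite divr_ge0 ?subr_ge0 ?ler_nat// ltW.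
have u1 : u <= 1.
  by rewrite ler_pdivrMr// mul1r -lerBrDr opprK -natrD ler_nat; lia.
have key a b : (a + b = n)%N -> L <= n%:R * rate_fun ((a%:R - b%:R) / n%:R) ->
    (b <= a)%N -> expR L <= (1 + u) ^+ a * (1 - u) ^+ b.
  move=> abn Lab ba; have a0a := mina0 _ (QP a b abn Lab ba).
  apply: (@le_trans _ _ (expR (n%:R * rate_fun u))); first by rewrite ler_expR.
  rewrite /u (@expR_rate_count a0 (n - a0)%N n)//; last by lia.
  rewrite -/u.
  have [d aE nE] : exists2 d, a = (a0 + d)%N & (n - a0 = d + b)%N.
    by exists (a - a0)%N; lia.
  rewrite aE nE !exprD -mulrA ler_wpM2l ?exprn_ge0//; first by lra.
  rewrite ler_wpM2r ?exprn_ge0//; first by lra.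
  by apply: lerXn2r; rewrite ?nnegrE; lra.
have pos a b : 0 <= (1 + u) ^+ a * (1 - u) ^+ b.
  by rewrite mulr_ge0 ?exprn_ge0//; lra.
exists u; split; first by rewrite u0 u1.
move=> a b abn Lab; case: (leqP b a) => [ba|/ltnW ab].
  apply: (le_trans (key _ _ abn Lab ba)); rewrite lerDl.
  by rewrite mulrC.
apply: (@le_trans _ _ ((1 + u) ^+ b * (1 - u) ^+ a)).
  by apply: key => //; [lia|rewrite swap].
by rewrite [leRHS]addrC mulrC [X in _ <= X + _]mulrC [X in X <= _ + _]mulrC lerDl.
Qed.

(** Weights of the layer-cake bound of [expR (rho * V)] by the sum over [j] of
    [expR (rho * j.+1)] times the indicator of [j <= V]; [tilt_level] pays for that
    indicator with a factor [expR (- j)]. *)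
Definition layer_weight rho (j : nat) : R := expR (rho * j.+1%:R - j%:R).

(** The geometric series of the layer weights, doubled for the two signs. *)
Definition layer_bound rho : R := 2 * (expR rho / (1 - expR (rho - 1))).

Lemma layer_weight_sum rho J : rho < 1 ->
  \sum_(q : 'I_J * bool) layer_weight rho q.1 <= layer_bound rho.
Proof.
move=> r1; rewrite -(pair_bigA _ (fun j b => layer_weight rho (nat_of_ord j)))/=.
rewrite (eq_bigr (fun j : 'I_J => 2 * layer_weight rho j)); last first.
  by move=> j _; rewrite big_bool/=; ring.
rewrite -mulr_sumr ler_wpM2l//.
have q1 : expR (rho - 1) < 1 by rewrite -[ltRHS](expR0 R) ltr_expR; lra.
have q0 := expR_gt0 (rho - 1).
have -> : \sum_(j < J) layer_weight rho j = expR rho * \sum_(j < J) expR (rho - 1) ^+ j.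
  rewrite mulr_sumr; apply: eq_bigr => j _.
  by rewrite -expRM_natl -expRD /layer_weight -natr1; congr expR; ring.
rewrite ler_wpM2l ?expR_ge0// -[leRHS]mul1r ler_pdivlMr ?subr_gt0//.
rewrite mulrC -opprB mulNr -subrX1 opprB lerBlDr lerDl exprn_ge0// ltW//.
Qed.

(** The layer [j = truncn V] alone dominates [expR (rho * V)], where [V] is the rate
    term; the other layers are nonnegative. The point of the mixture form is that it
    can be averaged exactly under the uniform law, block by block. *)
Lemma layer_mixture rho (n J : nat) : 0 <= rho -> (n < J)%N ->
  exists u : 'I_J * bool -> R,
  forall a b, (a + b = n)%N ->
  expR (rho * (n%:R * rate_fun ((a%:R - b%:R) / n%:R))) <=
    \sum_(q : 'I_J * bool) layer_weight rho q.1 * ((1 + u q) ^+ a * (1 - u q) ^+ b).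
Proof.
move=> r0 nJ.
pose u j := sval (cid (tilt_level n j%:R)).
have uP j : 0 <= u j <= 1 by rewrite /u; case: cid => ? [].
have uL j a b : (a + b = n)%N -> j%:R <= n%:R * rate_fun ((a%:R - b%:R) / n%:R : R) ->
  expR j%:R <= (1 + u j) ^+ a * (1 - u j) ^+ b + (1 - u j) ^+ a * (1 + u j) ^+ b.
  by rewrite /u; case: cid => ? [? H] /=; apply: H.
exists (fun q : 'I_J * bool => if q.2 then u q.1 else - u q.1) => a b abn.
set V := n%:R * _.
have m1 : `|(a%:R - b%:R) / n%:R : R| <= 1.
  case: (posnP n) => [->|n0]; first by rewrite invr0 mulr0 normr0.
  rewrite normrM normfV (ger0_norm (ler0n _ n)) ler_pdivrMr ?ltr0n// mul1r.
  rewrite -abn natrD ler_norml; have := ler0n R a; have := ler0n R b; lra.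
have V0 : 0 <= V by rewrite mulr_ge0// rate_fun_ge0.
have Vn : V <= n%:R by rewrite ler_piMr// rate_fun_le1.
pose j := Num.trunc V.
have /andP[jV Vj] := truncn_itv V0; rewrite -/j in jV Vj.
have jJ : (j < J)%N.
  by apply: leq_trans nJ; rewrite ltnS -(ler_nat R); apply: le_trans Vn.
rewrite -(pair_bigA _ (fun j b0 => layer_weight rho (nat_of_ord j) *
  ((1 + (if b0 then u j else - u j)) ^+ a * (1 - (if b0 then u j else - u j)) ^+ b)))/=.
have pos (i : 'I_J) (c : bool) : 0 <= layer_weight rho i *
  ((1 + (if c then u i else - u i)) ^+ a * (1 - (if c then u i else - u i)) ^+ b).
  have /andP[? ?] := uP i; apply: mulr_ge0; first exact: expR_ge0.
  by apply: mulr_ge0; apply: exprn_ge0; case: c; lra.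
rewrite (bigD1 (Ordinal jJ))//= [X in _ <= X + _]big_bool/= opprK -mulrDr.
apply: (@le_trans _ _ (layer_weight rho j * expR j%:R)).
  rewrite /layer_weight -expRD subrK ler_expR ler_wpM2l//; exact: ltW.
rewrite -[leLHS]addr0; apply: lerD.
  by rewrite ler_wpM2l ?expR_ge0//; apply: uL.
by apply: sumr_ge0 => i _; apply: sumr_ge0 => c _; apply: pos.
Qed.

End Mixture.

Section BlockMixture.
Context {R : realType} (N : nat) (I : finType) (blk : 'I_N -> I).

(** Blocks are the fibres of a labelling [blk] of the vertices. *)
Definition block_size (k : I) : nat := #|[pred i | blk i == k]|.

Definition block_sum (x : config N) (k : I) : R := \sum_(i | blk i == k) spin x i.

Definition block_mean (x : config N) (k : I) : R := block_sum x k / (block_size k)%:R.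

Let plus (x : config N) k := #|[pred i | (blk i == k) && x i]|.
Let minus (x : config N) k := #|[pred i | (blk i == k) && ~~ x i]|.

Lemma plus_minus x k : (plus x k + minus x k = block_size k)%N.
Proof.
rewrite /plus /minus /block_size -!sum1_card.
rewrite [RHS](bigID (fun i => x i))/=; congr addn.
Qed.

Lemma block_prod x k (u : R) : \prod_(i | blk i == k) (1 + u * spin x i) =
  (1 + u) ^+ plus x k * (1 - u) ^+ minus x k.
Proof.
rewrite (bigID (fun i => x i))/= /plus /minus -!prodr_const; congr (_ * _).
  by apply: eq_bigr => i /andP[_ xi]; rewrite /spin xi mulr1.
by apply: eq_bigr => i /andP[_ xi]; rewrite /spin (negbTE xi) mulrN1.
Qed.

Lemma block_sumE x k : block_sum x k = (plus x k)%:R - (minus x k)%:R.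
Proof.
rewrite /block_sum (bigID (fun i => x i))/=; congr (_ + _).
  rewrite (eq_bigr (fun=> 1)); first by rewrite sumr_const.
  by move=> i /andP[_ xi]; rewrite /spin xi.
rewrite (eq_bigr (fun=> -1)); first by rewrite sumr_const mulNrn.
by move=> i /andP[_ xi]; rewrite /spin (negbTE xi).
Qed.

Lemma norm_block_sum x k : `|block_sum x k| <= (block_size k)%:R.
Proof.
rewrite block_sumE -(plus_minus x) natrD ler_norml.
by have := ler0n R (plus x k); have := ler0n R (minus x k); lra.
Qed.

Lemma block_size_le k : (block_size k <= N)%N.
Proof. by rewrite -[leqRHS]card_ord max_card. Qed.

Lemma norm_block_mean x k : `|block_mean x k| <= 1.
Proof.
rewrite /block_mean; case: (posnP (block_size k)) => [->|n0].
  by rewrite invr0 mulr0 normr0.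
rewrite normrM normfV (ger0_norm (ler0n _ _)) ler_pdivrMr ?ltr0n// mul1r.
exact: norm_block_sum.
Qed.

(** The exponential moment of order [rho < 1] of the large-deviation rate is bounded
    uniformly in [N]. The product over the blocks of the mixtures [layer_mixture]
    expands into a mixture of product densities, each of uniform mean one, so that
    only the total weight remains. No polynomial factor in [N] is lost, unlike in a
    union bound over the values of the magnetizations. *)
Lemma mean_exp_rate_le (rho : R) : 0 <= rho < 1 ->
  unif_mean (fun x => expR (rho * \sum_k (block_size k)%:R * rate_fun (block_mean x k)))
  <= layer_bound rho ^+ #|I|.
Proof.
move=> /andP[r0 r1].
have H k := @layer_mixture R rho (block_size k) N.+1 r0 (block_size_le k).
pose u k := sval (cid (H k)).
have uP x k : expR (rho * ((block_size k)%:R * rate_fun (block_mean x k))) <=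
  \sum_(q : 'I_N.+1 * bool) layer_weight rho q.1 *
     \prod_(i | blk i == k) (1 + u k q * spin x i).
  rewrite /block_mean block_sumE /u; case: cid => /= v Hv.
  apply: (le_trans (Hv _ _ (plus_minus x k))).
  by apply: ler_sum => q _; rewrite block_prod.
pose T (f : {ffun I -> 'I_N.+1 * bool}) x :=
  (\prod_k layer_weight rho (f k).1) * \prod_i (1 + u (blk i) (f (blk i)) * spin x i).
apply: (@le_trans _ _ (unif_mean (fun x => \sum_f T f x))).
  apply: unif_mean_le => x; rewrite mulr_sumr expR_sum.
  apply: (@le_trans _ _ (\prod_k \sum_(q : 'I_N.+1 * bool) layer_weight rho q.1 *
     \prod_(i | blk i == k) (1 + u k q * spin x i))).
    by apply: ler_prod => k _; rewrite expR_ge0/=.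
  rewrite bigA_distr_bigA le_eqVlt; apply/orP; left; apply/eqP.
  apply: eq_bigr => f _; rewrite big_split/=; congr (_ * _).
  rewrite [RHS](partition_big blk predT)//=; apply: eq_bigr => k _.
  by apply: eq_bigr => i /eqP->.
rewrite unif_mean_sum; under eq_bigr do rewrite unif_meanZ unif_mean_tilt mulr1.
rewrite -(bigA_distr_bigA (fun _ (q : 'I_N.+1 * bool) => layer_weight rho q.1)).
rewrite -prodr_const; apply: ler_prod => k _.
rewrite layer_weight_sum// andbT; apply: sumr_ge0 => q _; exact: expR_ge0.
Qed.

End BlockMixture.

(** * The mean-field Hamiltonian *)

Section TupleSums.
Context {R : realType}.

Lemma big_tuple_tnth (p : nat) (I : Type) (t : p.-tuple I) (g : I -> R) :
  \prod_(k <- t) g k = \prod_(l < p) g (tnth t l).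
Proof. exact: big_tuple. Qed.

(** Distributivity, with tuples as choice functions. *)
Lemma sum_tuple_prod (p : nat) (I : finType) (F : 'I_p -> I -> R) :
  \sum_(t : p.-tuple I) \prod_(l < p) F l (tnth t l) = \prod_(l < p) \sum_i F l i.
Proof.
rewrite bigA_distr_bigA.
rewrite (reindex (fun f : {ffun 'I_p -> I} => [tuple f l | l < p]))/=.
  by apply: eq_bigr => f _; apply: eq_bigr => l _; rewrite tnth_mktuple.
exists (fun t : p.-tuple I => [ffun l => tnth t l]).
  by move=> f _; apply/ffunP => l; rewrite ffunE tnth_mktuple.
by move=> t _; apply: eq_from_tnth => l; rewrite tnth_mktuple ffunE.
Qed.

Lemma expn_ffact_le (n p : nat) : (n ^ p <= n ^_ p + p ^ 2 * n ^ p.-1)%N.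
Proof.
elim: p => [|p IH]; first by rewrite expn0 ffactn0 ltnS.
rewrite expnS ffactnSr /=.
have H : (n * n ^_ p <= n ^_ p * (n - p) + p * n ^ p)%N.
  have : (n ^_ p <= n ^ p)%N.
    rewrite ffact_prod; apply: (@leq_trans (\prod_(i < p) n)%N).
      by apply: leq_prod => i _; lia.
    by rewrite prod_nat_const card_ord.
  by nia.
have H2 : (n * (p ^ 2 * n ^ p.-1) <= p ^ 2 * n ^ p)%N.
  case: p {IH H} => [|p] /=; first by rewrite exp0n// !mul0n muln0.
  by rewrite mulnCA -expnS.
have := leq_mul (leqnn n) IH; rewrite mulnDr; nia.
Qed.

Lemma card_nonuniq_tuple (n p : nat) :
  (#|[pred t : p.-tuple 'I_n | ~~ uniq t]| <= p ^ 2 * n ^ p.-1)%N.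
Proof.
have H := expn_ffact_le n p.
have := cardC [pred t : p.-tuple 'I_n | uniq t].
rewrite card_tuple card_ord.
have -> : #|[pred t : p.-tuple 'I_n | uniq t]| = (n ^_ p)%N.
  rewrite -[in RHS](card_ord n) -card_uniq_tuples.
  apply: eq_card => t; rewrite !inE.
  by rewrite (_ : all _ _ = true)//; apply/allP => ? ?; rewrite inE.
move=> E; rewrite -(leq_add2l (n ^_ p)%N).
apply: leq_trans H; rewrite -E leq_add2l.
by apply/eq_leq/eq_card => t; rewrite !inE.
Qed.

Lemma norm_prod_le1 (I : Type) (s : seq I) (a : I -> R) :
  (forall k, `|a k| <= 1) -> `|\prod_(k <- s) a k| <= 1.
Proof.
move=> a1; rewrite normr_prod; elim: s => [|k s IH]; first by rewrite big_nil.
by rewrite big_cons mulr_ile1// prodr_ge0.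
Qed.

Lemma norm_prodB_le (I : Type) (s : seq I) (a b : I -> R) (e : R) :
  (forall k, `|a k| <= 1) -> (forall k, `|b k| <= 1) ->
  (forall k, `|a k - b k| <= e) ->
  `|\prod_(k <- s) a k - \prod_(k <- s) b k| <= (size s)%:R * e.
Proof.
move=> a1 b1 abe; elim: s => [|k s IH]; first by rewrite !big_nil subrr normr0 mul0r.
rewrite !big_cons/= -natr1 mulrDl mul1r.
set A := \prod_(j <- s) a j; set B := \prod_(j <- s) b j.
have -> : a k * A - b k * B = a k * (A - B) + (a k - b k) * B by ring.
apply: le_trans (ler_normD _ _) _; rewrite !normrM; apply: lerD.
  by apply: le_trans IH; rewrite ler_piMl.
by apply: le_trans (abe k); rewrite ler_piMr// norm_prod_le1.
Qed.

End TupleSums.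

Section Gibbs.
Context {R : realType} (N : nat) (m : 'I_N -> R).
Hypothesis m1 : forall i, `|m i| <= 1.

Let q (x : config N) : R := \prod_i (1 + m i * spin x i).

Lemma tilt_factor_ge0 x i : 0 <= 1 + m i * spin x i.
Proof.
have : `|m i * spin x i| <= 1 by rewrite normrM norm_spin mulr1.
by rewrite ler_norml; lra.
Qed.

Lemma ln_prod (I : finType) (g : I -> R) : (forall i, 0 < g i) ->
  ln (\prod_i g i) = \sum_i ln (g i).
Proof.
move=> g0; rewrite -[RHS]expRK expR_sum; congr ln; apply: eq_bigr => i _.
by rewrite lnK// posrE.
Qed.

(** The relative entropy, with respect to the uniform law, of the product measure
    of means [m]. *)
Lemma mean_tilt_entropy :
  unif_mean (fun x => q x * ln (q x)) = \sum_i rate_fun (m i).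
Proof.
have E x : q x * ln (q x) = \sum_i q x * ln (1 + m i * spin x i).
  rewrite -mulr_sumr; case: (eqVneq (q x) 0) => [->|qx]; first by rewrite !mul0r.
  rewrite /q ln_prod// => i; rewrite lt0r tilt_factor_ge0 andbT.
  by move: qx; rewrite /q => /prodf_neq0/(_ i isT).
rewrite (_ : (fun x => _) = (fun x => \sum_i q x * ln (1 + m i * spin x i))); last first.
  by apply/funext => x; rewrite E.
rewrite unif_mean_sum; apply: eq_bigr => i _.
pose s (b : bool) : R := if b then 1 else -1.
pose g j b : R := (1 + m j * s b) * (if j == i then ln (1 + m j * s b) else 1).
rewrite (_ : (fun x => _) = (fun x : config N => \prod_j g j (x j))); last first.
  apply/funext => x; rewrite /g big_split/=; congr (_ * _).
  by rewrite (bigD1 i)//= eqxx big1 ?mulr1// => j /negbTE->.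
rewrite unif_mean_prod (bigD1 i)//= big1 ?mulr1; last first.
  by move=> j /negbTE ji; rewrite /g ji /s; field.
by rewrite /g eqxx /s !mulr1 mulrN1 mulrC.
Qed.

Lemma mean_tilt_prod (t : seq 'I_N) : uniq t ->
  unif_mean (fun x => q x * \prod_(k <- t) spin x k) = \prod_(k <- t) m k.
Proof.
move=> ut.
have U (F : 'I_N -> R) : \prod_(k <- t) F k = \prod_k (if k \in t then F k else 1).
  by rewrite big_uniq//= big_mkcond.
pose s (b : bool) : R := if b then 1 else -1.
pose g j b : R := (1 + m j * s b) * (if j \in t then s b else 1).
rewrite (_ : (fun x => _) = (fun x : config N => \prod_j g j (x j))); last first.
  by apply/funext => x; rewrite U /g [RHS]big_split/=; congr (_ * _).
rewrite unif_mean_prod U; apply: eq_bigr => j _; rewrite /g /s.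
by case: ifP => _; field.
Qed.

(** Gibbs' variational principle: Jensen's inequality under the product measure of
    density [q], for the function [f - ln q]. Configurations of zero density only
    help, since the left-hand side ignores them. *)
Lemma gibbs_lower_bound (f : config N -> R) :
  expR (unif_mean (fun x => q x * f x) - \sum_i rate_fun (m i)) <=
  unif_mean (fun x => expR (f x)).
Proof.
set a := _ - _.
have q0 x : 0 <= q x by apply: prodr_ge0 => i _; apply: tilt_factor_ge0.
have H x : expR a * (q x * (1 - a) + (q x * f x + (-1) * (q x * ln (q x)))) <= expR (f x).
  have := q0 x; rewrite le_eqVlt => /orP[/eqP<-|qx].
    by rewrite !mul0r !mulr0 !addr0 mulr0 expR_ge0.
  have -> : expR (f x) = expR a * (q x * expR (f x - ln (q x) - a)).
    by rewrite -{1}[q x]lnK ?posrE// -!expRD; congr expR; ring.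
  rewrite ler_wpM2l ?expR_ge0//.
  have := ler_wpM2l (ltW qx) (expR_ge1Dx (f x - ln (q x) - a)); lra.
apply: le_trans (unif_mean_le H).
rewrite unif_meanZ unif_meanD unif_meanD unif_meanZ mean_tilt_entropy.
rewrite (_ : unif_mean (fun x => q x * (1 - a)) = 1 - a); last first.
  rewrite (_ : (fun x => _) = (fun x => (1 - a) * q x)).
    by rewrite unif_meanZ unif_mean_tilt mulr1.
  by apply/funext => x; rewrite mulrC.
by rewrite ler_pMr ?expR_gt0// /a; lra.
Qed.

End Gibbs.

Section MeanField.
Context {R : realType} (p K : nat) (lambda : 'I_K -> R) (Theta : tensor p K R).
Hypothesis p2 : (2 <= p)%N.
Hypothesis lambda_prop : proportion_vector lambda.
Hypothesis Theta01 : forall j, 0 <= Theta j <= 1.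

(** The conditional mean of the scaled adjacency tensor, given the blocks. *)
Definition mean_tensor N (blk : 'I_N -> 'I_K) : tensor p N R :=
  fun t => (uniq t)%:R * Theta (map_tuple blk t) / N%:R ^+ p.-1.

(** Mean-field energy per vertex as a function of the block magnetizations;
    [hsbm_phi] is [beta * energy] minus the weighted rates. *)
Definition energy (m : 'I_K -> R) : R :=
  \sum_(j : p.-tuple 'I_K) Theta j * \prod_(k <- j) (lambda k * m k).

Definition balanced N (blk : 'I_N -> 'I_K) : Prop :=
  forall k, `|(block_size blk k)%:R - N%:R * lambda k| <= 1.

Definition energy_error : R := p%:R ^+ 2 + K%:R ^+ p * p%:R.

Lemma lambda_le1 k : 0 <= lambda k <= 1.
Proof.
case: lambda_prop => l0 l1; rewrite l0/= -l1 (bigD1 k)//= lerDl.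
by apply: sumr_ge0.
Qed.

(** A sum over vertices in which the weight depends on the blocks alone is a
    polynomial in the block sums. *)
Lemma sum_block_prod N (blk : 'I_N -> 'I_K) (F : 'I_N -> R) :
  \sum_(j : p.-tuple 'I_K) Theta j * \prod_(k <- j) (\sum_(i | blk i == k) F i) =
  \sum_(t : p.-tuple 'I_N) Theta (map_tuple blk t) * \prod_(k <- t) F k.
Proof.
under eq_bigr => j _.
  rewrite big_tuple_tnth.
  under eq_bigr do rewrite big_mkcond.
  rewrite -sum_tuple_prod mulr_sumr; over.
rewrite exchange_big/=; apply: eq_bigr => t _.
rewrite (bigD1 (map_tuple blk t))//= [X in _ + X]big1 ?addr0.
  rewrite big_tuple_tnth; congr (_ * _); apply: eq_bigr => l _.
  by rewrite tnth_map eqxx.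
move=> j jt; suff [l ll] : exists l, blk (tnth t l) != tnth j l.
  by rewrite (bigD1 l)//= (negbTE ll) mul0r mulr0.
apply/existsP; rewrite -negb_forall; apply: contra jt => /forallP H.
by apply/eqP; apply: eq_from_tnth => l; rewrite tnth_map; apply/esym/eqP.
Qed.

(** Two errors, both bounded uniformly in [N]: tuples with a repeated vertex are
    [O(N^(p-1))] in number, each of weight [N^-(p-1)]; and rounding the block sizes
    changes each factor of a product by at most [1 / N]. *)
Lemma mean_tensor_energy N (blk : 'I_N -> 'I_K) (F : 'I_N -> R) (m : 'I_K -> R) :
  (0 < N)%N -> balanced blk -> (forall i, `|F i| <= 1) -> (forall k, `|m k| <= 1) ->
  (forall k, \sum_(i | blk i == k) F i = (block_size blk k)%:R * m k) ->
  `|\sum_(t : p.-tuple 'I_N) mean_tensor blk t * \prod_(k <- t) F k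
     - N%:R * energy m| <= energy_error.
Proof.
move=> N0 bal F1 m1 Fm; have NR : 0 < N%:R :> R by rewrite ltr0n.
have NRn : N%:R != 0 :> R by rewrite gt_eqF.
have Np : 0 < N%:R ^+ p.-1 :> R by rewrite exprn_gt0.
set A := \sum_t _.
pose B := (\sum_(t : p.-tuple 'I_N) Theta (map_tuple blk t) * \prod_(k <- t) F k)
   / N%:R ^+ p.-1.
have AB : `|A - B| <= p%:R ^+ 2.
  rewrite /A /B mulr_suml -sumrB.
  apply: le_trans (ler_norm_sum _ _ _) _.
  apply: (@le_trans _ _ (\sum_(t : p.-tuple 'I_N | ~~ uniq t) (N%:R ^+ p.-1)^-1)).
    rewrite [leRHS]big_mkcond/=; apply: ler_sum => t _; rewrite /mean_tensor.
    case: (uniq t) => /=; first by rewrite mul1r mulrAC subrr normr0.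
    rewrite !mul0r sub0r normrN normrM normfV (ger0_norm (ltW Np)).
    rewrite ler_piMl ?invr_ge0 ?(ltW Np)// normrM mulr_ile1//.
      by rewrite ger0_norm; have /andP[] := Theta01 (map_tuple blk t).
    exact: norm_prod_le1.
  rewrite sumr_const -[X in X <= _]mulr_natr mulrC ler_pdivrMr//.
  by rewrite -!natrX -natrM ler_nat card_nonuniq_tuple.
have BE : `|B - N%:R * energy m| <= K%:R ^+ p * p%:R.
  rewrite /B -sum_block_prod.
  have -> : (\sum_(j : p.-tuple 'I_K)
      Theta j * \prod_(k <- j) (\sum_(i | blk i == k) F i)) / N%:R ^+ p.-1
    = N%:R * \sum_(j : p.-tuple 'I_K) Theta j *
        \prod_(k <- j) ((block_size blk k)%:R * m k / N%:R).
    rewrite mulr_suml mulr_sumr; apply: eq_bigr => j _.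
    under eq_bigr do rewrite Fm.
    rewrite [X in _ = _ * (_ * X)]big_split/=.
    rewrite (_ : \prod_(k <- j) N%:R^-1 = (N%:R ^+ p)^-1); last first.
      by rewrite big_tuple_tnth prodr_const card_ord exprVn.
    have -> : N%:R ^+ p = N%:R * N%:R ^+ p.-1 :> R by rewrite -exprS prednK//; lia.
    by field; rewrite NRn/= (gt_eqF Np).
  rewrite -mulrBr /energy -sumrB normrM (gtr0_norm NR).
  apply: (@le_trans _ _ (N%:R * (\sum_(j : p.-tuple 'I_K) p%:R * N%:R^-1))).
    rewrite ler_wpM2l ?(ltW NR)//; apply: le_trans (ler_norm_sum _ _ _) _.
    apply: ler_sum => j _; rewrite -mulrBr normrM.
    have /andP[T0 T1] := Theta01 j.
    apply: (@le_trans _ _ (1 * (p%:R / N%:R))); last by rewrite mul1r.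
    apply: ler_pM => //; first by rewrite ger0_norm.
    rewrite -[X in X%:R / _](size_tuple j); apply: norm_prodB_le => k.
    - rewrite normrM normfV (gtr0_norm NR) ler_pdivrMr// mul1r normrM.
      rewrite -[leRHS]mulr1 ler_pM// ger0_norm// ler_nat; exact: block_size_le.
    - have /andP[l0 l1] := lambda_le1 k.
      by rewrite normrM mulr_ile1// ger0_norm.
    - rewrite mulrAC -mulrBl normrM; apply: (@le_trans _ _ (N%:R^-1 * 1)); last by rewrite mulr1.
      apply: ler_pM => //.
      rewrite -[X in _ <= X]mul1r ler_pdivlMr//.
      rewrite -[X in _ * X](gtr0_norm NR) -normrM.
      rewrite (_ : _ * _ = (block_size blk k)%:R - N%:R * lambda k) ?bal//.
      by field.
  rewrite sumr_const card_tuple card_ord -[X in _ * X <= _]mulr_natr natrX.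
  by rewrite le_eqVlt; apply/orP; left; apply/eqP; field.
by have := ler_distD B A (N%:R * energy m); rewrite /energy_error; lra.
Qed.

Lemma block_rate_le N (blk : 'I_N -> 'I_K) (m : 'I_K -> R) : balanced blk ->
  (forall k, `|m k| <= 1) ->
  `|\sum_k (block_size blk k)%:R * rate_fun (m k) - N%:R * \sum_k lambda k * rate_fun (m k)|
   <= K%:R.
Proof.
move=> bal m1; rewrite mulr_sumr -sumrB; apply: le_trans (ler_norm_sum _ _ _) _.
apply: (@le_trans _ _ (\sum_(k < K) 1)); last by rewrite sumr_const card_ord.
apply: ler_sum => k _; rewrite mulrA -mulrBl normrM mulr_ile1//.
by rewrite ger0_norm ?rate_fun_le1// rate_fun_ge0.
Qed.

Lemma norm_energy_le (m : 'I_K -> R) : `|energy m| <= energy (fun k => `|m k|).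
Proof.
apply: le_trans (ler_norm_sum _ _ _) _; apply: ler_sum => j _.
have /andP[T0 _] := Theta01 j.
rewrite normrM (ger0_norm T0) ler_wpM2l// normr_prod.
rewrite le_eqVlt; apply/orP; left; apply/eqP; apply: eq_bigr => k _.
by have /andP[l0 _] := lambda_le1 k; rewrite normrM (ger0_norm l0).
Qed.

Lemma block_meanE N (blk : 'I_N -> 'I_K) (x : config N) k :
  \sum_(i | blk i == k) spin x i = (block_size blk k)%:R * block_mean blk x k :> R.
Proof.
rewrite /block_mean; case: (posnP (block_size blk k)) => [n0|n0].
  rewrite n0 mul0r; apply/eqP; rewrite -normr_le0.
  by have := norm_block_sum (R := R) blk x k; rewrite n0.
by rewrite mulrCA mulfV ?mulr1// gt_eqF// ltr0n.
Qed.

(** If the functional at [beta1] is nonpositive, the energy at [beta < beta1] is at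
    most [beta / beta1] times the large-deviation rate, up to a constant, and
    [mean_exp_rate_le] applies. Nonnegativity of [Theta] allows the magnetizations to
    be replaced by their absolute values, hence both signs of the Hamiltonian to be
    treated at once. *)
Lemma mean_field_bounded (beta beta1 : R) : 0 <= beta < beta1 ->
  (forall t : 'I_K -> R, (forall k, 0 <= t k <= 1) ->
     hsbm_phi lambda Theta beta1 t <= 0) ->
  exists C : R, forall N (blk : 'I_N -> 'I_K), (0 < N)%N -> balanced blk ->
    unif_mean (fun x => expR (beta * `|hamiltonian (mean_tensor blk) x|)) <= C.
Proof.
move=> /andP[b0 bb1] phi0; have b10 : 0 < beta1 by lra.
pose rho := beta / beta1.
have r01 : 0 <= rho < 1 by rewrite divr_ge0 ?(ltW b10)//= ltr_pdivrMr ?mul1r.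
exists (expR (beta * energy_error + K%:R) * layer_bound rho ^+ K) => N blk N0 bal.
have bnd := mean_exp_rate_le blk r01; rewrite card_ord in bnd.
apply: le_trans (ler_wpM2l (expR_ge0 _) bnd).
rewrite -unif_meanZ; apply: unif_mean_le => x; rewrite -expRD ler_expR.
have m1 := norm_block_mean (R := R) blk x.
have s1 i : `|spin x i : R| <= 1 by rewrite norm_spin.
have H1 := mean_tensor_energy N0 bal s1 m1 (block_meanE blk x).
rewrite -/(hamiltonian (mean_tensor blk) x) in H1.
set m := block_mean blk x in H1 m1 *.
have am1 k : `| `|m k| | <= 1 by rewrite normr_id.
have NR : 0 <= N%:R :> R by [].
have H2 : `|hamiltonian (mean_tensor blk) x| <= N%:R * energy (fun k => `|m k|) + energy_error.
  have := ler_wpM2l NR (norm_energy_le m).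
  have := ler_normD (hamiltonian (mean_tensor blk) x - N%:R * energy m) (N%:R * energy m).
  by rewrite subrK [X in _ <= _ + X]normrM (ger0_norm NR); lra.
have H3 := phi0 (fun k => `|m k|); rewrite /hsbm_phi -/(energy _) subr_le0 in H3.
have {}H3 := H3 (fun k => introT andP (conj (normr_ge0 (m k)) (m1 k))).
have H4 := block_rate_le bal am1; rewrite ler_norml in H4; case/andP: H4 => H4 _.
have H5 : beta * energy (fun k => `|m k|) <= rho * \sum_k lambda k * rate_fun `|m k|.
  have -> : beta = rho * beta1 by rewrite divfK// gt_eqF.
  by rewrite -mulrA ler_wpM2l//; case/andP: r01.
have H6 := ler_wpM2l NR H5.
have H7 := ler_wpM2l b0 H2.
have H8 : rho * (N%:R * (\sum_k lambda k * rate_fun `|m k|)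
   - \sum_k (block_size blk k)%:R * rate_fun `|m k|) <= 1 * K%:R.
  apply: (@le_trans _ _ (rho * K%:R)).
    by rewrite ler_wpM2l; [lra| case/andP: r01|lra].
  by rewrite ler_wpM2r//; case/andP: r01; lra.
rewrite (eq_bigr (fun k => (block_size blk k)%:R * rate_fun `|m k|)); last first.
  by move=> k _; rewrite rate_fun_norm.
nra.
Qed.

(** [gibbs_lower_bound] for the product measure whose mean is [t k] on block [k]. *)
Lemma mean_field_lower (beta : R) (t : 'I_K -> R) N (blk : 'I_N -> 'I_K) :
  0 <= beta -> (forall k, 0 <= t k <= 1) -> (0 < N)%N -> balanced blk ->
  expR (N%:R * hsbm_phi lambda Theta beta t - (beta * energy_error + K%:R)) <=
  unif_mean (fun x => expR (beta * hamiltonian (mean_tensor blk) x)).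
Proof.
move=> b0 t01 N0 bal.
have t1 k : `|t k| <= 1 by rewrite ger0_norm; case/andP: (t01 k).
pose m i := t (blk i).
have m1 i : `|m i| <= 1 by apply: t1.
apply: le_trans (gibbs_lower_bound m1 _); rewrite ler_expR.
have -> : \sum_i rate_fun (m i) = \sum_k (block_size blk k)%:R * rate_fun (t k).
  rewrite (partition_big blk predT)//=; apply: eq_bigr => k _.
  rewrite (eq_bigr (fun=> rate_fun (t k))); last by move=> i /eqP ik; rewrite /m ik.
  by rewrite sumr_const mulr_natl.
have -> : unif_mean (fun x => \prod_i (1 + m i * spin x i) *
    (beta * hamiltonian (mean_tensor blk) x)) =
  beta * \sum_(s : p.-tuple 'I_N) mean_tensor blk s * \prod_(k <- s) m k.
  rewrite (_ : (fun x => _) = (fun x => beta * \sum_(s : p.-tuple 'I_N) mean_tensor blk s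
     * (\prod_i (1 + m i * spin x i) * \prod_(k <- s) spin x k))); last first.
    apply/funext => x; rewrite mulrCA; congr (_ * _); rewrite mulr_sumr.
    by apply: eq_bigr => s _; rewrite mulrCA.
  rewrite unif_meanZ unif_mean_sum; congr (_ * _); apply: eq_bigr => s _.
  rewrite unif_meanZ; case: (boolP (uniq s)) => [us|nus].
    by rewrite mean_tilt_prod.
  by rewrite /mean_tensor (negbTE nus) !mul0r.
have H1 := @mean_tensor_energy N blk m t N0 bal m1 t1.
have {}H1 : `|\sum_(t0 : p.-tuple 'I_N) mean_tensor blk t0 * \prod_(k <- t0) m k
   - N%:R * energy t| <= energy_error.
  apply: H1 => k; rewrite (eq_bigr (fun=> t k)); last by move=> i /eqP ik; rewrite /m ik.
  by rewrite sumr_const mulr_natl.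
have H2 := block_rate_le bal t1.
rewrite !ler_norml in H1 H2; case/andP: H1 => H1 _; case/andP: H2 => _ H2.
have := ler_wpM2l b0 H1; rewrite /hsbm_phi -/(energy t) mulrN mulrBr mulrBr.
by rewrite [N%:R * (beta * _)]mulrCA; lra.
Qed.

End MeanField.

(** * Replica moments of the edge noise *)

Section MultiMean.
Context {R : realType} (N k : nat).
Local Notation multi := {ffun 'I_k -> config N}.

(** Expectation over [k] independent uniform replicas: a [k]-th power of [unif_mean]
    is such an expectation. *)
Definition multi_mean (F : multi -> R) : R := (2 ^- N) ^+ k * \sum_X F X.

Lemma multi_mean_le (F H : multi -> R) : (forall X, F X <= H X) ->
  multi_mean F <= multi_mean H.
Proof.
by move=> FH; rewrite ler_wpM2l ?exprn_ge0 ?invr_ge0 ?exprn_ge0//; apply: ler_sum.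
Qed.

Lemma multi_mean_sum (I : finType) (F : I -> multi -> R) :
  multi_mean (fun X => \sum_i F i X) = \sum_i multi_mean (F i).
Proof. by rewrite /multi_mean exchange_big/= mulr_sumr. Qed.

Lemma multi_meanZ c (F : multi -> R) :
  multi_mean (fun X => c * F X) = c * multi_mean F.
Proof. by rewrite /multi_mean -mulr_sumr mulrCA. Qed.

Lemma multi_mean_prod (g : 'I_k -> config N -> R) :
  multi_mean (fun X => \prod_r g r (X r)) = \prod_r unif_mean (g r).
Proof.
by rewrite /multi_mean -(bigA_distr_bigA g) big_split/= prodr_const card_ord.
Qed.

Lemma multi_mean_coord (g : config N -> R) r :
  multi_mean (fun X => g (X r)) = unif_mean g.
Proof.
rewrite (_ : (fun X => _) = (fun X : {ffun 'I_k -> config N} => \prod_s (if s == r then g else cst 1) (X s))).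
  rewrite (multi_mean_prod (fun s => if s == r then g else cst 1)).
  rewrite (bigD1 r)//= eqxx big1 ?mulr1// => s /negbTE->.
  by rewrite unif_mean_cst.
apply/funext => X; rewrite (bigD1 r)//= eqxx big1 ?mulr1// => s /negbTE->//.
Qed.

(** The pointwise product of spins, in the boolean encoding of configurations. *)
Definition agree (x y : config N) : config N := [ffun i => x i == y i].

Lemma spin_agree x y i : spin (agree x y) i = spin x i * spin y i :> R.
Proof. by rewrite /spin ffunE; case: (x i); case: (y i) => /=; lra. Qed.

Lemma agreeK x : involutive (agree x).
Proof. by move=> y; apply/ffunP => i; rewrite !ffunE; case: (x i); case: (y i). Qed.

(** The products of the spins of two distinct replicas are uniform, by the
    involution that replaces one replica by its product with the other. *)
Lemma multi_mean_agree (g : config N -> R) r s : r != s ->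
  multi_mean (fun X => g (agree (X s) (X r))) = unif_mean g.
Proof.
move=> rs; rewrite -(multi_mean_coord g r); congr (_ * _).
pose h (X : multi) : multi := [ffun q => if q == r then agree (X s) (X r) else X q].
have hK : involutive h.
  move=> X; apply/ffunP => q; rewrite !ffunE eqxx (eq_sym s) (negbTE rs).
  by case: eqP => // ->; rewrite agreeK.
rewrite [RHS](reindex_inj (inv_inj hK)); apply: eq_bigr => X _.
by rewrite ffunE eqxx.
Qed.

End MultiMean.

Section NoiseMoment.
Context {R : realType} (p N k : nat) (E : finType) (ed : E -> p.-tuple 'I_N).
Variables (w theta : E -> R) (c D : R).
Hypothesis p2 : (2 <= p)%N.
Hypothesis N0 : (0 < N)%N.
Hypothesis k0 : (0 < k)%N.
Hypothesis ed_inj : injective ed.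
Hypothesis theta01 : forall e, 0 <= theta e <= 1.
Hypothesis wD : forall e, 0 <= w e <= D / N%:R ^+ p.-1.
Hypothesis kN : 16 * (2 * c ^+ 2 * D ^+ 2) * k%:R ^+ 2 <= N%:R.

(** Centred edge indicators [b e - theta e], each spread over the spins of the edge. *)
Definition noise (b : {ffun E -> bool}) (x : config N) : R :=
  \sum_e w e * ((b e)%:R - theta e) * \prod_(v <- ed e) spin x v.

Definition bernoulli_weight (b : {ffun E -> bool}) : R :=
  \prod_e (if b e then theta e else 1 - theta e).

Let A := 2 * c ^+ 2 * D ^+ 2.

Definition overlap (x y : config N) : R := (\sum_i spin x i * spin y i) / N%:R.

Let NR : 0 < N%:R :> R. Proof. by rewrite ltr0n. Qed.
Let N1 : 1 <= N%:R :> R. Proof. by rewrite ler1n. Qed.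
Let Np : 0 < N%:R ^+ p.-1 :> R. Proof. by rewrite exprn_gt0. Qed.

Lemma norm_overlap x y : `|overlap x y| <= 1.
Proof.
rewrite normrM normfV (gtr0_norm NR) ler_pdivrMr// mul1r.
apply: le_trans (ler_norm_sum _ _ _) _.
rewrite (eq_bigr (fun=> 1)); first by rewrite sumr_const card_ord.
by move=> i _; rewrite normrM !norm_spin mulr1.
Qed.

Let V (X : {ffun 'I_k -> config N}) e : R :=
  c * w e * \sum_r \prod_(v <- ed e) spin (X r) v.

(** The smallness required by [bernoulli_mgf_le]: [V] has order [k / N^(p-1)], and
    [k^2] is at most of order [N]. *)
Lemma norm_V X e : `|V X e| <= 2^-1.
Proof.
have /andP[w0 w1] := wD e.
have D0 : 0 <= D by have := le_trans w0 w1; rewrite pmulr_lge0// invr_gt0.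
have S1 : `|\sum_r \prod_(v <- ed e) spin (X r) v : R| <= k%:R.
  apply: le_trans (ler_norm_sum _ _ _) _.
  apply: (@le_trans _ _ (\sum_(r < k) 1)); last by rewrite sumr_const card_ord.
  by apply: ler_sum => r _; apply: norm_prod_le1 => v; rewrite norm_spin.
have wN : w e <= D / N%:R.
  apply: le_trans w1 _; rewrite ler_wpM2l// lef_pV2 ?posrE//.
  by rewrite -[leLHS]expr1 ler_weXn2l//; lia.
have H1 : `|V X e| <= `|c| * (D / N%:R) * k%:R.
  by rewrite /V 2!normrM; do 2 (apply: ler_pM => //); rewrite ger0_norm.
apply: le_trans H1 _.
have H2 : (2 * (`|c| * D * k%:R)) ^+ 2 <= N%:R ^+ 2.
  apply: (@le_trans _ _ (N%:R)); last by rewrite -[leLHS]expr1 ler_weXn2l.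
  apply: le_trans kN.
  have -> : (2 * (`|c| * D * k%:R)) ^+ 2 = 2 * (2 * c ^+ 2 * D ^+ 2 * k%:R ^+ 2).
    by rewrite !exprMn real_normK ?num_real//; ring.
  have : 0 <= 2 * c ^+ 2 * D ^+ 2 * k%:R ^+ 2.
    by do 3 (apply: mulr_ge0; last exact: sqr_ge0).
  by lra.
have H3 : 2 * (`|c| * D * k%:R) <= N%:R.
  by rewrite -(@ler_pXn2r _ 2)// nnegrE ?mulr_ge0// ltW.
have -> : `|c| * (D / N%:R) * k%:R = (`|c| * D * k%:R) / N%:R by ring.
by rewrite ler_pdivrMr//; lra.
Qed.

Let Q (X : {ffun 'I_k -> config N}) : R :=
  \sum_(rs : 'I_k * 'I_k) (rs.1 != rs.2)%:R * overlap (X rs.2) (X rs.1) ^+ 2.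

(** Summing over all tuples instead of the edges turns the square of a sum over
    replicas into [p]-th powers of overlaps. Since [p >= 2] and overlaps are at most
    one, their squares suffice; the diagonal contributes [k]. *)
Lemma sum_V_sqr X : 2 * \sum_e V X e ^+ 2 <= A * (k%:R + Q X).
Proof.
pose S (t : p.-tuple 'I_N) : R := \sum_(r < k) \prod_(v <- t) spin (X r) v.
have H1 e : V X e ^+ 2 <= (c ^+ 2 * D ^+ 2) * ((N%:R ^+ p.-1)^-1 ^+ 2 * S (ed e) ^+ 2).
  have /andP[w0 w1] := wD e.
  have H : w e ^+ 2 <= D ^+ 2 * (N%:R ^+ p.-1)^-1 ^+ 2.
    by rewrite -exprMn ler_pXn2r// nnegrE// (le_trans w0).
  have -> : V X e ^+ 2 = c ^+ 2 * w e ^+ 2 * S (ed e) ^+ 2.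
    by rewrite /V -/(S (ed e)) !exprMn.
  rewrite [leRHS](_ : _ = c ^+ 2 * (D ^+ 2 * (N%:R ^+ p.-1)^-1 ^+ 2) * S (ed e) ^+ 2).
    by rewrite ler_wpM2r ?sqr_ge0// ler_wpM2l ?sqr_ge0.
  by rewrite !mulrA.
have H2 : \sum_e S (ed e) ^+ 2 <= \sum_t S t ^+ 2.
  rewrite -(big_imset (fun t => S t ^+ 2) (in2W ed_inj))/=.
  rewrite big_mkcond/=; apply: ler_sum => t _.
  by case: ifP => // _; apply: sqr_ge0.
have H3 : \sum_t S t ^+ 2 = \sum_(rs : 'I_k * 'I_k) (N%:R * overlap (X rs.2) (X rs.1)) ^+ p.
  rewrite -(pair_bigA _ (fun r s => (N%:R * overlap (X s) (X r)) ^+ p))/=.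
  rewrite (eq_bigr (fun t : p.-tuple 'I_N => \sum_r \sum_s
      \prod_(l < p) (spin (X s) (tnth t l) * spin (X r) (tnth t l)))); last first.
    move=> t _; rewrite expr2 /S mulr_suml; apply: eq_bigr => r _.
    rewrite mulr_sumr; apply: eq_bigr => s _.
    by rewrite !big_tuple_tnth -big_split/=; apply: eq_bigr => l _; rewrite mulrC.
  rewrite exchange_big/=; apply: eq_bigr => r _.
  rewrite exchange_big/=; apply: eq_bigr => s _.
  rewrite (sum_tuple_prod (fun _ i => spin (X s) i * spin (X r) i)).
  by rewrite prodr_const card_ord /overlap mulrC divfK// gt_eqF.
have H4 (o : R) : `|o| <= 1 -> (N%:R ^+ p.-1)^-1 ^+ 2 * (N%:R * o) ^+ p <= o ^+ 2.
  move=> o1; case: p p2 => [//|[//|q]] _ /=.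
  have -> : (N%:R ^+ q.+1)^-1 ^+ 2 * (N%:R * o) ^+ q.+2 = (N%:R ^+ q)^-1 * o ^+ q * o ^+ 2.
    by rewrite exprMn !exprS; field; rewrite expf_neq0 ?gt_eqF.
  rewrite ler_piMl ?sqr_ge0//.
  apply: le_trans (ler_norm _) _; rewrite normrM mulr_ile1//.
    by rewrite normfV ger0_norm ?exprn_ge0// invf_le1 ?exprn_gt0// exprn_ege1.
  by rewrite normrX exprn_ile1.
have H5 : \sum_e V X e ^+ 2 <= (c ^+ 2 * D ^+ 2) * (k%:R + Q X).
  apply: le_trans (ler_sum _ (fun e _ => H1 e)) _.
  rewrite -mulr_sumr -mulr_sumr; apply: ler_wpM2l.
    by apply: mulr_ge0; exact: sqr_ge0.
  apply: le_trans (ler_wpM2l (sqr_ge0 (N%:R ^+ p.-1)^-1) H2) _.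
  rewrite H3 mulr_sumr.
  have -> : k%:R = \sum_(rs : 'I_k * 'I_k) (rs.1 == rs.2)%:R :> R.
    rewrite -(pair_bigA _ (fun r s : 'I_k => (r == s)%:R))/=.
    rewrite (eq_bigr (fun=> 1)); first by rewrite sumr_const card_ord.
    move=> r _; rewrite (bigD1 r)//= eqxx big1 ?addr0// => s.
    by rewrite eq_sym => /negbTE->.
  rewrite /Q -big_split/=; apply: ler_sum => rs _.
  apply: le_trans (H4 _ (norm_overlap _ _)) _.
  case: eqP => /= _; last by rewrite add0r mul1r.
  rewrite mul0r addr0 -real_normK ?num_real// exprn_ile1// norm_overlap//.
rewrite (_ : A * _ = 2 * (c ^+ 2 * D ^+ 2 * (k%:R + Q X))); last by rewrite /A !mulrA.
by rewrite ler_wpM2l.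
Qed.

(** The squared magnetization is dominated by the rate function, so that this is
    [mean_exp_rate_le] for a single block. *)
Lemma mean_exp_overlap_le (a : R) : 16 * a <= N%:R -> 0 <= a ->
  unif_mean (fun x : config N => expR (a * ((\sum_i spin x i) / N%:R) ^+ 2)) <= layer_bound 2^-1.
Proof.
move=> aN a0.
have := @mean_exp_rate_le R N unit (fun=> tt) 2^-1.
rewrite card_unit expr1 => H; apply: le_trans (H _); last by lra.
apply: unif_mean_le => x; rewrite ler_expR.
rewrite (bigD1 tt)//= [X in _ <= _ * (_ + X)]big1 ?addr0//.
have nb : block_size (fun _ : 'I_N => tt) tt = N.
  by rewrite -[RHS]card_ord; apply: eq_card => i; rewrite !inE.
have := norm_block_mean (R := R) (fun _ : 'I_N => tt) x tt.
move/rate_fun_ge_sqr; rewrite nb.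
have -> : block_mean (fun _ : 'I_N => tt) x tt = (\sum_i spin x i) / N%:R :> R.
  by rewrite /block_mean nb.
set m := _ / N%:R; move=> Im.
have : a * m ^+ 2 <= N%:R / 16 * m ^+ 2 by apply: ler_wpM2r; [exact: sqr_ge0 | lra].
have := ler_wpM2l (ltW NR) Im; lra.
Qed.

Lemma layer_bound_ge1 : 1 <= layer_bound 2^-1 :> R.
Proof.
apply: le_trans (@mean_exp_overlap_le 0 _ _) => //; last by rewrite mulr0.
rewrite (_ : (fun x => _) = (fun=> 1)) ?unif_mean_cst//.
by apply/funext => x; rewrite mul0r expR0.
Qed.

Lemma bernoulli_weight_mgf (v : E -> R) : (forall e, `|v e| <= 2^-1) ->
  \sum_b bernoulli_weight b * expR (\sum_e v e * ((b e)%:R - theta e)) <=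
  expR (2 * \sum_e v e ^+ 2).
Proof.
move=> v1; pose g e (b : bool) : R :=
  (if b then theta e else 1 - theta e) * expR (v e * (b%:R - theta e)).
rewrite (eq_bigr (fun b : {ffun E -> bool} => \prod_e g e (b e))); last first.
  by move=> b _; rewrite expR_sum /g [RHS]big_split.
rewrite -(bigA_distr_bigA g) mulr_sumr expR_sum; apply: ler_prod => e _.
rewrite big_bool /g; have /andP[t0 t1] := theta01 e; apply/andP; split.
  by apply: addr_ge0; rewrite mulr_ge0 ?expR_ge0//; lra.
exact: bernoulli_mgf_le.
Qed.

(** The [k]-th moment of the quenched exponential moment of the noise is at most a
    constant times [expR (A * k)]. Averaging over the edges leaves the exponential of
    a sum of squared overlaps over the pairs of replicas; by convexity it is at most
    the average over the pairs of single-pair exponentials, and each of these has a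
    bounded mean as long as [k^2] is small compared to [N]. That [k] may grow with [N]
    is what makes the tail summable, also when [p = 2]. *)
Lemma noise_moment :
  \sum_b bernoulli_weight b * unif_mean (fun x => expR (c * noise b x)) ^+ k
  <= expR (A * k%:R) * layer_bound 2^-1.
Proof.
have bw0 b : 0 <= bernoulli_weight b.
  by apply: prodr_ge0 => e _; case: ifP; have := theta01 e; lra.
have -> : \sum_b bernoulli_weight b * unif_mean (fun x => expR (c * noise b x)) ^+ k
  = multi_mean (fun X => \sum_b bernoulli_weight b *
      expR (\sum_e V X e * ((b e)%:R - theta e))).
  rewrite multi_mean_sum; apply: eq_bigr => b _; rewrite multi_meanZ; congr (_ * _).
  rewrite -[k in LHS]card_ord -prodr_const -multi_mean_prod; congr (_ * _).
  apply: eq_bigr => X _; rewrite -expR_sum; congr expR.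
  rewrite -mulr_sumr /noise exchange_big/= mulr_sumr; apply: eq_bigr => e _.
  by rewrite -mulr_sumr /V; ring.
apply: (@le_trans _ _ (multi_mean (fun X => expR (A * k%:R) *
   \sum_(rs : 'I_k * 'I_k) (k%:R ^+ 2)^-1 *
     expR (A * k%:R ^+ 2 * ((rs.1 != rs.2)%:R * overlap (X rs.2) (X rs.1) ^+ 2))))).
  apply: multi_mean_le => X.
  apply: le_trans (bernoulli_weight_mgf (norm_V X)) _.
  apply: (@le_trans _ _ (expR (A * (k%:R + Q X)))); first by rewrite ler_expR sum_V_sqr.
  rewrite mulrDr expRD ler_wpM2l ?expR_ge0//.
  have kR : (k%:R ^+ 2 : R) != 0 by rewrite expf_neq0// pnatr_eq0 -lt0n.
  have -> : A * Q X = \sum_(rs : 'I_k * 'I_k) (k%:R ^+ 2)^-1 *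
     (A * k%:R ^+ 2 * ((rs.1 != rs.2)%:R * overlap (X rs.2) (X rs.1) ^+ 2)).
    rewrite /Q mulr_sumr; apply: eq_bigr => rs _.
    by rewrite [RHS]mulrA; congr (_ * _); rewrite mulrCA mulVf ?mulr1.
  apply: expR_jensen => [rs|]; first by rewrite invr_ge0 sqr_ge0.
  by rewrite sumr_const card_prod card_ord -[X in X = 1]mulr_natl natrM -expr2 mulfV.
rewrite multi_meanZ ler_wpM2l ?expR_ge0// multi_mean_sum.
have kR : (0 < k%:R ^+ 2 :> R) by rewrite exprn_gt0// ltr0n.
apply: (@le_trans _ _ (\sum_(rs : 'I_k * 'I_k) (k%:R ^+ 2)^-1 * layer_bound 2^-1)).
  apply: ler_sum => -[r s] _; rewrite multi_meanZ ler_wpM2l ?invr_ge0 ?(ltW kR)//=.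
  case: eqP => [_|/eqP rs] /=.
    rewrite (_ : multi_mean _ = 1) ?layer_bound_ge1//.
    rewrite -[RHS](@unif_mean_cst R N 1) -(multi_mean_coord _ r); congr multi_mean.
    by apply/funext => X; rewrite mul0r mulr0 expR0.
  have A0 : 0 <= A by do 2 (apply: mulr_ge0; last exact: sqr_ge0).
  rewrite (_ : (fun X => _) = (fun X : {ffun 'I_k -> config N} => (fun x =>
     expR (A * k%:R ^+ 2 * ((\sum_i spin x i) / N%:R) ^+ 2)) (agree (X s) (X r)))).
    rewrite (multi_mean_agree (fun x =>
     expR (A * k%:R ^+ 2 * ((\sum_i spin x i) / N%:R) ^+ 2)) rs).
    apply: mean_exp_overlap_le; first by rewrite mulrA.
    by rewrite mulr_ge0// ltW.
  apply/funext => X; rewrite mul1r /overlap.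
  suff -> : \sum_i spin (X s) i * spin (X r) i = \sum_i spin (agree (X s) (X r)) i :> R by [].
  by apply: eq_bigr => i _; rewrite spin_agree.
rewrite sumr_const card_prod card_ord -[X in X <= _]mulr_natl natrM -expr2 mulrA mulfV ?mul1r//.
by rewrite gt_eqF.
Qed.

End NoiseMoment.

(** * Blocks, edges and the law of the hypergraph *)

Section BlockAssignment.
Context {R : realType} (K : nat) (lambda : 'I_K.+1 -> R).
Hypothesis lambda_prop : proportion_vector lambda.

Let cum_le (k : 'I_K.+1) : R := \sum_(i < K.+1 | (i <= k)%N) lambda i.
Let cum_lt (k : 'I_K.+1) : R := \sum_(i < K.+1 | (i < k)%N) lambda i.

Let lambda0 i : 0 <= lambda i. Proof. by case: lambda_prop. Qed.

Definition assign N (v : 'I_N) : 'I_K.+1 :=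
  [arg min_(k < ord_max | (v.+1)%:R <= N%:R * cum_le k) (k : nat)].

Lemma cum_max : cum_le ord_max = 1.
Proof.
case: lambda_prop => _ <-; apply: eq_bigl => i; exact: leq_ord.
Qed.

Lemma mem_assign N (v : 'I_N) k : (v \in block lambda N k) = (assign v == k).
Proof.
rewrite /assign; case: arg_minnP => [|j vj minj].
  by rewrite cum_max mulr1 ler_nat.
have lt_j : N%:R * cum_lt j < (v.+1)%:R.
  rewrite ltNge; apply/negP => H.
  case: (posnP j) => [j0|j0].
    move: H; rewrite /cum_lt big_pred0; first by rewrite mulr0 lern0.
    by move=> i; rewrite j0.
  have ij : (j.-1 < K.+1)%N by apply: leq_ltn_trans (ltn_ord j); apply: leq_pred.
  have cum_pred : cum_le (Ordinal ij) = cum_lt j.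
    by apply: eq_bigl => i; rewrite /= -ltnS prednK.
  have := minj (Ordinal ij); rewrite cum_pred => /(_ H) /=.
  by rewrite leqNgt prednK// leqnn.
rewrite inE -/(cum_le k) -/(cum_lt k).
case: eqP => [<-|/eqP jk]; first by rewrite lt_j.
have sum_sub (a b : 'I_K.+1) : (a < b)%N -> cum_le a <= cum_lt b.
  move=> ab; rewrite /cum_le /cum_lt big_mkcond [leRHS]big_mkcond/=.
  apply: ler_sum => i _; case: ifP => ia; case: ifP => ib //.
  by move: ib; rewrite (leq_ltn_trans ia ab).
case: (ltngtP j k) => [jltk|kltj|/val_inj jek]; last by rewrite jek eqxx in jk.
- have H : (v.+1)%:R <= N%:R * cum_lt k.
    by apply: (le_trans vj); rewrite ler_wpM2l ?sum_sub.
  by rewrite ltNge H.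
- have H : N%:R * cum_le k < (v.+1)%:R.
    by apply: le_lt_trans lt_j; rewrite ler_wpM2l ?sum_sub.
  by rewrite [_ <= N%:R * cum_le k]leNgt H andbF.
Qed.

Lemma card_below N (y : R) : 0 <= y <= N%:R ->
  #|[pred v : 'I_N | (v.+1)%:R <= y]| = Num.trunc y.
Proof.
move=> /andP[y0 yN].
have tN : (Num.trunc y <= N)%N by rewrite -(ler_nat R) (le_trans _ yN)// truncn_le.
rewrite -sum1_card (eq_bigl (fun v : 'I_N => (v < Num.trunc y)%N)); last first.
  by move=> v; rewrite !inE -truncn_ge_nat.
by rewrite (big_ord_narrow tN) sum1_card card_ord.
Qed.

(** Both ends of a block are rounded down, so that the errors cancel up to one. *)
Lemma assign_balanced N : balanced lambda (@assign N).
Proof.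
move=> k.
have lt1 : 0 <= cum_lt k by apply: sumr_ge0.
have ltle : cum_lt k <= cum_le k.
  rewrite /cum_le /cum_lt big_mkcond [leRHS]big_mkcond/=.
  apply: ler_sum => i _; case: ifP => ia; case: ifP => ib //.
  by move: ib; rewrite (ltnW ia).
have le1 : cum_le k <= 1.
  rewrite -cum_max /cum_le big_mkcond [leRHS]big_mkcond/=.
  apply: ler_sum => i _; case: ifP => ia; case: ifP => ib //.
  by move: ib; rewrite leq_ord.
have diff : cum_le k - cum_lt k = lambda k.
  rewrite /cum_le /cum_lt (bigD1 k)//= [X in lambda k + X - _](eq_bigl (fun i : 'I_K.+1 => (i < k)%N)).
    by rewrite addrK.
  by move=> i; rewrite ltn_neqAle andbC.
have NR : 0 <= N%:R :> R by [].
have c1 := @card_below N (N%:R * cum_lt k); have c2 := @card_below N (N%:R * cum_le k).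
rewrite mulr_ge0//= ler_piMr// in c1; last exact: le_trans le1.
rewrite mulr_ge0//= ?ler_piMr// in c2; last exact: le_trans ltle.
have E : (block_size (@assign N) k + Num.trunc (N%:R * cum_lt k) = Num.trunc (N%:R * cum_le k))%N.
  rewrite -c1// -c2// /block_size -!sum1_card [RHS](bigID (fun v : 'I_N => (v.+1)%:R <= N%:R * cum_lt k))/=.
  rewrite addnC; congr addn; apply: eq_bigl => v; rewrite !inE.
    rewrite [RHS]andbC; case: (boolP (_ <= N%:R * cum_lt k)) => // H.
    by rewrite (le_trans H)// ler_wpM2l.
  by rewrite -mem_assign inE -ltNge andbC.
have t1 := truncn_itv (mulr_ge0 NR lt1); have t2 := truncn_itv (mulr_ge0 NR (le_trans lt1 ltle)).
rewrite -E in t2; move: t1 t2; rewrite -!natr1 natrD -diff mulrBr ler_norml.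
by move=> /andP[? ?] /andP[? ?]; apply/andP; split; lra.
Qed.

End BlockAssignment.

Section Symmetrization.
Context {R : realType} (p N : nat).

(** The multiplicity of an edge in a sum over tuples. *)
Definition orderings (e : increasing_tuple p N) : nat :=
  #|[pred t : p.-tuple 'I_N | perm_eq t (sval e)]|.

Lemma uniq_increasing (e : increasing_tuple p N) : uniq (sval e).
Proof.
rewrite -(map_inj_uniq val_inj); apply: (sorted_uniq ltn_trans ltnn).
exact: (svalP e).
Qed.

Lemma orderings_le e : (orderings e <= p`!)%N.
Proof.
rewrite -[p in p`!](size_tuple (sval e)) -size_permutations ?uniq_increasing//.
rewrite /orderings cardE -(size_map val); apply: uniq_leq_size.
  by rewrite (map_inj_uniq val_inj) enum_uniq.
by move=> s /mapP[t]; rewrite mem_enum inE => ts ->; rewrite mem_permutations perm_sym perm_sym.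
Qed.

Lemma exists_increasing (t : p.-tuple 'I_N) : uniq t ->
  exists e : increasing_tuple p N, perm_eq t (sval e).
Proof.
move=> ut; pose s := sort_tuple (fun a b : 'I_N => (a <= b)%N) t.
have ss : sorted ltn [seq val k | k <- s].
  rewrite ltn_sorted_uniq_leq (map_inj_uniq val_inj) sort_uniq ut /=.
  by rewrite sorted_map; apply: sort_sorted => a b; exact: leq_total.
by exists (exist _ s ss); rewrite /= perm_sym perm_sort.
Qed.

Lemma increasing_inj (e f : increasing_tuple p N) :
  perm_eq (sval e) (sval f) -> e = f.
Proof.
move=> ef; apply/val_inj/val_inj => /=; apply: (inj_map val_inj).
apply: (irr_sorted_eq ltn_trans ltnn (svalP e) (svalP f)).
by apply: perm_mem; apply: perm_map.
Qed.

Lemma sum_uniq_tuple (F : p.-tuple 'I_N -> R) :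
  (forall s t : p.-tuple 'I_N, perm_eq s t -> F s = F t) ->
  \sum_(t : p.-tuple 'I_N | uniq t) F t =
  \sum_(e : increasing_tuple p N) (orderings e)%:R * F (sval e).
Proof.
move=> symF.
transitivity (\sum_(t : p.-tuple 'I_N) \sum_(e : increasing_tuple p N)
   (perm_eq t (sval e))%:R * F t).
  rewrite big_mkcond/=; apply: eq_bigr => t _; case: ifP => ut.
    have [e te] := exists_increasing ut.
    rewrite (bigD1 e)//= te mul1r big1 ?addr0// => f fe.
    case: (boolP (perm_eq t (sval f))) => tf; last by rewrite mul0r.
    case/negP: fe; apply/eqP/increasing_inj; rewrite perm_sym in tf.
    exact: perm_trans tf te.
  rewrite big1// => e _; case: (boolP (perm_eq t (sval e))) => te; last by rewrite mul0r.
  by rewrite (perm_uniq te) uniq_increasing in ut.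
rewrite exchange_big/=; apply: eq_bigr => e _.
rewrite /orderings -sum1_card natr_sum mulr_suml [RHS]big_mkcond/=.
by apply: eq_bigr => t _; rewrite inE; case: ifP => te; rewrite ?mul0r// (symF _ _ te).
Qed.

End Symmetrization.

Section NoiseTail.
Context {R : realType} d (Omega : measurableType d) (P : probability Omega R).
Context (p K N : nat) (lambda : 'I_K -> R) (Theta : tensor p K R).
Variables (G : Omega -> hypergraph p N) (blk : 'I_N -> 'I_K).
Hypothesis p2 : (2 <= p)%N.
Hypothesis N0 : (0 < N)%N.
Hypothesis symT : symmetric_tensor Theta.
Hypothesis Theta01 : forall j, 0 <= Theta j <= 1.
Hypothesis GP : is_HSBM P lambda Theta G.
Hypothesis blkP : forall v, v \in block lambda N (blk v).

(** The part of the Hamiltonian that is due to the randomness of the hypergraph. *)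
Definition fluctuation (J : tensor p N R) (x : config N) : R :=
  hamiltonian J x - hamiltonian (mean_tensor Theta blk) x.

Let theta (e : increasing_tuple p N) := Theta (map_tuple blk (sval e)).
Let w (e : increasing_tuple p N) : R := (orderings e)%:R / N%:R ^+ p.-1.
Let edges (o : Omega) : {ffun increasing_tuple p N -> bool} :=
  [ffun e => adjacency (G o) (sval e)].

Lemma fluctuationE o x :
  fluctuation (scaled_adjacency R (G o)) x = noise val w theta (edges o) x.
Proof.
rewrite /fluctuation /hamiltonian -sumrB.
rewrite (bigID (fun t : p.-tuple 'I_N => uniq t))/= [X in _ + X]big1 ?addr0; last first.
  move=> t nut; rewrite /scaled_adjacency /mean_tensor /adjacency (negbTE nut)/=.
  by rewrite !mul0r subrr.
rewrite (sum_uniq_tuple (F := fun t => _)); last first.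
  move=> s t st; rewrite /scaled_adjacency /mean_tensor /adjacency (perm_uniq st).
  rewrite (symT (perm_map blk st)).
  have -> : [set k0 in (s : seq 'I_N)]%SET = [set k0 in (t : seq 'I_N)]%SET.
    by apply/setP => v; rewrite !inE (perm_mem st).
  by rewrite (perm_big t st).
apply: eq_bigr => e _; rewrite /w /theta /edges ffunE /scaled_adjacency /mean_tensor.
by rewrite uniq_increasing mul1r -mulrBl -mulrBl; ring.
Qed.

(** The edge indicators are independent, so that the law of the whole hypergraph is
    a product of Bernoulli weights on a finite cube. *)
Lemma edges_law b :
  measurable [set o | edges o = b] /\
  P [set o | edges o = b] = (bernoulli_weight theta b)%:E.
Proof.
have E : [set o | edges o = b] = \bigcap_(e in [set: increasing_tuple p N])
    ((fun o => adjacency (G o) (sval e)) @^-1` [set b e]).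
  apply/seteqP; split => o /=.
    by move=> <- e _; rewrite /edges ffunE.
  by move=> H; apply/ffunP => e; rewrite ffunE; apply: H.
have mE e : measurable ((fun o => adjacency (G o) (sval e)) @^-1` [set b e]).
  by rewrite -[X in measurable X]setTI; apply: (hsbm_measurable GP).
split.
  rewrite E; apply: fin_bigcap_measurable => //; exact: finite_finset.
rewrite E (hsbm_independent GP (B := fun e => [set b e]))//.
congr EFin; apply: eq_bigr => e _.
rewrite (@hsbm_law _ _ _ _ _ _ _ _ _ _ GP e (map_tuple blk (sval e))); last first.
  by move=> l; rewrite tnth_map.
rewrite bernoulli_probE// -/(theta e).
have in1 (a c : bool) : (a \in [set c]) = (a == c).
  by apply/idP/eqP; rewrite in_setE.
by rewrite !diracE !in1; case: (b e); rewrite /= /unstable.onem; ring.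
Qed.

Lemma sub_additive_bigsetU (I : Type) (s : seq I) (Q : pred I) (F : I -> set Omega) :
  (forall i, measurable (F i)) ->
  (P (\big[setU/set0]_(i <- s | Q i) F i) <= \sum_(i <- s | Q i) P (F i))%E.
Proof.
move=> mF; elim: s => [|i s IH]; first by rewrite !big_nil measure0.
rewrite !big_cons; case: ifP => // _.
apply: le_trans (measureU2 _ _ _) _ => //.
  by apply: bigsetU_measurable => j _.
by rewrite leeD2l.
Qed.

(** Markov's inequality for the [k]-th power, by [noise_moment]. *)
Lemma fluctuation_tail (c C : R) (k : nat) : (0 < k)%N -> 0 < C ->
  16 * (2 * c ^+ 2 * (p`!)%:R ^+ 2) * k%:R ^+ 2 <= N%:R ->
  let bad := [set o | C < unif_mean (fun x =>
     expR (c * fluctuation (scaled_adjacency R (G o)) x))] in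
  measurable bad /\
  (P bad <= (expR (2 * c ^+ 2 * (p`!)%:R ^+ 2 * k%:R) * layer_bound 2^-1 / C ^+ k)%:E)%E.
Proof.
move=> k0 C0 kN bad.
pose Y b := unif_mean (fun x => expR (c * noise val w theta b x)).
have YE o : unif_mean (fun x => expR (c * fluctuation (scaled_adjacency R (G o)) x))
    = Y (edges o).
  by congr unif_mean; apply/funext => x; rewrite fluctuationE.
have badE : bad = \big[setU/set0]_(b <- index_enum {ffun increasing_tuple p N -> bool} | C < Y b)
    [set o | edges o = b].
  rewrite -bigcup_seq_cond; apply/seteqP; split => o; rewrite /bad /= YE.
    by move=> H; exists (edges o) => //=; rewrite mem_index_enum.
  by move=> [b /= /andP[_ Hb] eb]; rewrite eb.
split.
  by rewrite badE; apply: bigsetU_measurable => b _; case: (edges_law b).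
rewrite badE; apply: le_trans (sub_additive_bigsetU _ _ _) _.
  by move=> b; case: (edges_law b).
under eq_bigr do rewrite (edges_law _).2.
rewrite sumEFin lee_fin.
have w01 e : 0 <= w e <= (p`!)%:R / N%:R ^+ p.-1.
  rewrite /w divr_ge0 ?exprn_ge0//= ler_wpM2r ?invr_ge0 ?exprn_ge0//.
  by rewrite ler_nat orderings_le.
have th01 e : 0 <= theta e <= 1 by apply: Theta01.
have M := noise_moment p2 N0 k0 (@val_inj _ _ _) th01 w01 kN.
have Ck : 0 < C ^+ k by rewrite exprn_gt0.
rewrite ler_pdivlMr//; apply: le_trans M.
rewrite mulr_suml big_mkcond/=; apply: ler_sum => b _.
have bw0 : 0 <= bernoulli_weight theta b.
  by apply: prodr_ge0 => e _; case: ifP; have := th01 e; lra.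
have Y0 : 0 <= Y b by apply: unif_mean_ge0 => x; apply: expR_ge0.
case: ifP => CY; last by rewrite mulr_ge0// exprn_ge0.
rewrite ler_wpM2l// lerXn2r// ?nnegrE//; exact: ltW.
Qed.

End NoiseTail.

(** * Almost sure bounds on the fluctuation *)

Section Summability.
Context {R : realType}.

(** With [m] a third of the logarithm, [k^2 <= 9 * (2^m)^2] and [N >= (2^m)^3]. *)
Lemma trunc_log_sqr_le (A : R) : 0 <= A ->
  \forall N \near \oo, A * (trunc_log 2 N)%:R ^+ 2 <= N%:R.
Proof.
move=> A0; pose M := (Num.trunc (9 * A)).+1.
exists (2 ^ (3 * M))%N => // N /= MN.
have N0 : (0 < N)%N by apply: leq_trans MN; rewrite expn_gt0.
set k := trunc_log 2 N.
have kM : (3 * M <= k)%N by apply: trunc_log_max.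
pose m := (k %/ 3)%N.
have Mm : (M <= m)%N by rewrite leq_divRL// mulnC.
have km : (k <= 3 * 2 ^ m)%N.
  have : (m < 2 ^ m)%N by apply: ltn_expl.
  by rewrite /m; have := ltn_ceil k (isT : (0 < 3)%N); lia.
have Nm : (2 ^ m * (2 ^ m) ^ 2 <= N)%N.
  apply: leq_trans (trunc_logP (isT : (1 < 2)%N) N0).
  by rewrite -expnS -expnM leq_exp2l// -/k /m; have := leq_trunc_div k 3; lia.
have AM : 9 * A <= (2 ^ m)%:R.
  apply: (@le_trans _ _ M%:R); first by apply: ltW; rewrite -truncn_le_nat.
  by rewrite ler_nat (leq_trans Mm)// ltnW// ltn_expl.
apply: (@le_trans _ _ ((2 ^ m)%:R * (2 ^ m)%:R ^+ 2)); last first.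
  by rewrite -natrX -natrM ler_nat.
apply: (@le_trans _ _ (9 * A * (2 ^ m)%:R ^+ 2)); last by rewrite ler_wpM2r// sqr_ge0.
have : k%:R ^+ 2 <= 9 * (2 ^ m)%:R ^+ 2 :> R.
  by rewrite -!natrX -natrM ler_nat; have := leq_mul km km; rewrite !mulnn expnMn.
by move=> /(ler_wpM2l A0); lra.
Qed.

Lemma sum_inv_sqr_le m : \sum_(n < m) (n%:R ^+ 2)^-1 <= 2 :> R.
Proof.
have H q : \sum_(n < q.+2) (n%:R ^+ 2)^-1 <= 2 - (q.+1%:R)^-1 :> R.
  elim: q => [|q IH].
    by rewrite !big_ord_recr big_ord0/= expr0n/= invr0 expr1n invr1; lra.
  rewrite big_ord_recr/=; apply: le_trans (lerD IH (lexx _)) _.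
  have q0 : 0 < q.+1%:R :> R by [].
  have -> : q.+2%:R = q.+1%:R + 1 :> R by rewrite natr1.
  move: q.+1%:R q0 => x x0.
  rewrite -subr_ge0.
  have -> : 2 - (x + 1)^-1 - (2 - x^-1 + ((x + 1) ^+ 2)^-1) = (x * (x + 1) ^+ 2)^-1.
    by field; rewrite !gt_eqF//; lra.
  by rewrite invr_ge0 mulr_ge0 ?sqr_ge0// ltW.
case: m => [|[|m]]; first by rewrite big_ord0.
  by rewrite big_ord_recr big_ord0/= expr0n/= invr0; lra.
by apply: le_trans (H m) _; rewrite gerBl.
Qed.

End Summability.

Section AlmostSure.
Context {R : realType} d (Omega : measurableType d) (P : probability Omega R).

(** Borel-Cantelli for tails of order [1 / n^2]. *)
Lemma borel_cantelli_inv_sqr (F : nat -> set Omega) (C : R) : 0 <= C ->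
  (\forall n \near \oo, measurable (F n) /\ (P (F n) <= (C * (n%:R ^+ 2)^-1)%:E)%E) ->
  {ae P, forall o, \forall n \near \oo, ~ F n o}.
Proof.
move=> C0 [n0 _ Fn].
pose H n := if (n0 <= n)%N then F n else set0.
have mH n : measurable (H n).
  by rewrite /H; case: ifP => // nn; case: (Fn n nn).
have PH n : (P (H n) <= (C * (n%:R ^+ 2)^-1)%:E)%E.
  rewrite /H; case: ifP => nn; first by case: (Fn n nn).
  by rewrite measure0 lee_fin mulr_ge0// invr_ge0 sqr_ge0.
have sumH : (\sum_(0 <= n <oo) P (H n) < +oo)%E.
  apply: (@le_lt_trans _ _ (C * 2)%:E); last exact: ltry.
  apply: lime_le; first by apply: is_cvg_nneseries.
  apply: nearW => m; rewrite big_mkord.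
  apply: (@le_trans _ _ (\sum_(n < m) (C * (n%:R ^+ 2)^-1)%:E)%E).
    by apply: lee_sum => n _; apply: PH.
  by rewrite sumEFin lee_fin -mulr_sumr ler_wpM2l// sum_inv_sqr_le.
exists (lim_sup_set H); split.
- apply: bigcapT_measurable => n; apply: bigcup_measurable => k _; exact: mH.
- exact: lim_sup_set_cvg0.
- move=> o /= nF n _; apply: contrapT => nH; apply: nF.
  exists (maxn n n0) => // m /=; rewrite geq_max => /andP[nm n0m] Fm.
  by apply: nH; exists m => //; rewrite /H n0m.
Qed.

Context (p K : nat) (lambda : 'I_K -> R) (Theta : tensor p K R).
Variables (G : forall N, Omega -> hypergraph p N) (blk : forall N, 'I_N -> 'I_K).
Hypothesis p2 : (2 <= p)%N.
Hypothesis symT : symmetric_tensor Theta.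
Hypothesis Theta01 : forall j, 0 <= Theta j <= 1.
Hypothesis GP : forall N, (1 <= N)%N -> is_HSBM P lambda Theta (G N).
Hypothesis blkP : forall N (v : 'I_N), v \in block lambda N (blk v).

(** Moments of logarithmic order [k] in [fluctuation_tail] give a tail of order
    [4^-k], which is of order [1 / N^2] and thus summable. *)
Lemma fluctuation_ae (c : R) : exists C : R,
  {ae P, forall o, \forall N \near \oo,
    unif_mean (fun x => expR (c * fluctuation Theta (@blk N) (scaled_adjacency R (G N o)) x)) <= C}.
Proof.
pose A : R := 2 * c ^+ 2 * (p`!)%:R ^+ 2.
have A0 : 0 <= A by do 2 (apply: mulr_ge0; last exact: sqr_ge0).
(* the moment bound [expR (A * k)] over [C ^+ k] leaves [4 ^- k] *)
exists (4 * expR A); set C := 4 * _.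
have C0 : 0 < C by rewrite mulr_gt0// expR_gt0.
pose F N := [set o | C < unif_mean (fun x =>
  expR (c * fluctuation Theta (@blk N) (scaled_adjacency R (G N o)) x))].
have L0 : 0 <= 4 * layer_bound 2^-1 :> R.
  have := @mean_exp_overlap_le R 1 isT 0; have := @layer_bound_ge1 R 1 isT; lra.
suff BC : \forall N \near \oo, measurable (F N) /\
    (P (F N) <= (4 * layer_bound 2^-1 * (N%:R ^+ 2)^-1)%:E)%E.
  apply: filterS (borel_cantelli_inv_sqr L0 BC) => o.
  by apply: filterS => N /negP; rewrite -leNgt.
have A16 : 0 <= 16 * A by rewrite mulr_ge0.
near=> N.
have N2 : (2 <= N)%N by near: N; exists 2.
have N0 : (0 < N)%N by apply: ltnW.
have k0 : (0 < trunc_log 2 N)%N by rewrite trunc_log_gt0.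
have kN : 16 * A * (trunc_log 2 N)%:R ^+ 2 <= N%:R.
  by near: N; apply: trunc_log_sqr_le.
have [mF PF] := fluctuation_tail p2 N0 symT Theta01 (GP N0) (@blkP N) k0 C0 kN.
split => //; apply: le_trans PF _; rewrite lee_fin -/A.
set k := trunc_log 2 N.
rewrite /C exprMn -expRM_natr -mulrA.
have -> : expR (A * k%:R) * (layer_bound 2^-1 / (4 ^+ k * expR (A * k%:R))) = layer_bound 2^-1 / 4 ^+ k.
  by field; rewrite expf_neq0// gt_eqF// expR_gt0.
have NR : 0 < N%:R ^+ 2 :> R by rewrite exprn_gt0// ltr0n.
rewrite ler_pdivrMr ?exprn_gt0// mulrAC ler_pdivlMr//.
have N4 : N%:R ^+ 2 <= 4 * 4 ^+ k :> R.
  rewrite -!natrX -natrM ler_nat -expnS (_ : 4 = 2 ^ 2)%N// -expnM mulnC expnM leq_sqr.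
  by apply: ltnW; apply: trunc_log_ltn.
rewrite [leRHS](_ : _ = layer_bound 2^-1 * (4 * 4 ^+ k)); last by ring.
by apply: ler_wpM2l => //; lra.
Unshelve. all: by end_near.
Qed.

End AlmostSure.

(** * The hyperbolic tangent *)

Section Tanh.
Context {R : realType}.
Implicit Types a b u s : R.

Lemma tanhN u : tanh (- u) = - tanh u.
Proof. by rewrite /tanh opprK -mulNr opprB [X in _ / X]addrC. Qed.

Lemma tanh_den_gt0 u : 0 < expR u + expR (- u).
Proof. by rewrite addr_gt0 ?expR_gt0. Qed.

Lemma norm_tanh_le1 u : `|tanh u| <= 1.
Proof.
rewrite /tanh normrM normfV (gtr0_norm (tanh_den_gt0 u)).
rewrite ler_pdivrMr ?tanh_den_gt0// mul1r ler_norml.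
by have := expR_gt0 u; have := expR_gt0 (- u); lra.
Qed.

(** In the variable [expR (2 * u)] the function [tanh] is a Moebius map. *)
Lemma sub_tanhE a b : tanh a - tanh b =
  2 * (expR (2 * a) - expR (2 * b)) / ((expR (2 * a) + 1) * (expR (2 * b) + 1)).
Proof.
have e2 u : expR (2 * u) = expR u ^+ 2 by rewrite -expRM_natl.
have eN u : expR (- u) = (expR u)^-1 by rewrite expRN.
rewrite /tanh !e2 !eN; have := expR_gt0 a; have := expR_gt0 b.
move: (expR a) (expR b) => x y y0 x0.
field; rewrite !gt_eqF//; have := mulr_gt0 x0 x0; have := mulr_gt0 y0 y0; nra.
Qed.

Lemma sub_tanh_le a b : `|tanh a - tanh b| <= 4 * `|a - b|.
Proof.
wlog ab : a b / b <= a.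
  move=> H; case: (leP b a) => [|/ltW] /H //.
  by rewrite distrC [X in _ <= _ * X]distrC.
have A0 := expR_gt0 (2 * a); have B0 := expR_gt0 (2 * b).
have BA : expR (2 * b) <= expR (2 * a) by rewrite ler_expR; lra.
have H : expR (2 * a) - expR (2 * b) <= expR (2 * a) * (2 * (a - b)).
  have := expR_ge1Dx (2 * b - 2 * a) => /(ler_wpM2l (ltW A0)).
  by rewrite -expRD [2 * a + _]addrC subrK; lra.
rewrite [X in _ <= _ * X]ger0_norm ?subr_ge0// sub_tanhE ger0_norm; last first.
  by rewrite divr_ge0 ?mulr_ge0//; lra.
rewrite ler_pdivrMr; last by apply: mulr_gt0; lra.
move: H A0 B0; have : 0 <= a - b by lra.
move: (expR (2 * a)) (expR (2 * b)) (a - b) => x y z z0 H x0 y0.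
apply: (@le_trans _ _ (2 * (x * (2 * z)))); first by lra.
have := mulr_ge0 z0 (ltW x0); have := mulr_ge0 z0 (ltW y0).
have := mulr_ge0 (mulr_ge0 z0 (ltW y0)) (ltW x0); nra.
Qed.

(** On a bounded interval [tanh] has derivative bounded away from zero. *)
Lemma sub_tanh_ge (M a b : R) : b <= a -> - M <= b -> a <= M ->
  expR (- (2 * M)) ^+ 2 * (a - b) <= tanh a - tanh b.
Proof.
move=> ab Mb aM; rewrite sub_tanhE.
have B0 := expR_gt0 (2 * b); have A0 := expR_gt0 (2 * a).
have Bm : expR (- (2 * M)) <= expR (2 * b) by rewrite ler_expR; lra.
have Am : expR (- (2 * M)) * expR (2 * a) <= 1.
  by rewrite -expRD -[leRHS](expR0 R) ler_expR; lra.
have r0 := expR_gt0 (- (2 * M)).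
have r1 : expR (- (2 * M)) <= 1 by rewrite -[leRHS](expR0 R) ler_expR; lra.
have H : expR (2 * b) * (2 * (a - b)) <= expR (2 * a) - expR (2 * b).
  have := expR_ge1Dx (2 * a - 2 * b) => /(ler_wpM2l (ltW B0)).
  by rewrite -expRD [2 * b + _]addrC subrK; lra.
rewrite ler_pdivlMr; last by apply: mulr_gt0; lra.
move: H Bm Am r0 r1 A0 B0; have : 0 <= a - b by lra.
move: (expR (- (2 * M))) (expR (2 * a)) (expR (2 * b)) (a - b) => r x y z z0 H ry rx r0 r1 x0 y0.
apply: (@le_trans _ _ (2 * (y * (2 * z)))); last by lra.
have h1 : r * (x + 1) <= 2 by rewrite mulrDr mulr1; lra.
have h2 : r * (y + 1) <= 2 * y.
  have : r * y <= 1 * y by rewrite ler_wpM2r// ltW.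
  by rewrite mulrDr mulr1; lra.
have h3 : (r * (x + 1)) * (r * (y + 1)) <= 2 * (2 * y).
  by apply: ler_pM => //; apply: mulr_ge0; lra.
have -> : r ^+ 2 * z * ((x + 1) * (y + 1)) = z * ((r * (x + 1)) * (r * (y + 1))) by ring.
have -> : 2 * (y * (2 * z)) = z * (2 * (2 * y)) by ring.
exact: ler_wpM2l.
Qed.

Lemma mul_tanh_norm c u : u * tanh (c * u) = `|u| * tanh (c * `|u|).
Proof. by case: (ger0P u) => // _; rewrite mulrN tanhN mulrNN. Qed.

(** [fun c => u * tanh (c * u)] is even in [u] and increasing in [c], with slope at
    least of order [u^2]: this is the curvature of the pseudo-likelihood. *)
Lemma mul_tanh_ge (M c c' u : R) : 0 <= c' <= c -> c <= M -> `|u| <= 1 ->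
  expR (- (2 * M)) ^+ 2 * (c - c') * u ^+ 2 <= u * tanh (c * u) - u * tanh (c' * u).
Proof.
move=> /andP[c'0 cc'] cM u1; rewrite (mul_tanh_norm c) (mul_tanh_norm c') -mulrBr -[u ^+ 2]real_normK ?num_real//.
have u0 := normr_ge0 u; move: `|u| u0 u1 => v v0 v1.
have -> : expR (- (2 * M)) ^+ 2 * (c - c') * v ^+ 2
  = v * (expR (- (2 * M)) ^+ 2 * (c * v - c' * v)) by ring.
apply: ler_wpM2l => //; apply: sub_tanh_ge.
- by rewrite ler_wpM2r.
- have := mulr_ge0 c'0 v0; lra.
- by apply: (le_trans _ cM); rewrite ler_piMr//; lra.
Qed.

(** Detailed balance for one spin of conditional mean [tanh u]. *)
Lemma tanh_flip s u : `|s| = 1 -> s - tanh u = expR (- (2 * (s * u))) * (s + tanh u).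
Proof.
have e2 v : expR (2 * v) = expR v ^+ 2 by rewrite -expRM_natl.
have x0 := expR_gt0 u; have := tanh_den_gt0 u.
rewrite /tanh !expRN e2 => d0.
case: (ger0P s) => _ E.
  by rewrite E mul1r; field; rewrite ?gt_eqF//.
have -> : s = -1 by rewrite -E opprK.
rewrite mulN1r expRN; move: (expR u) x0 d0 => x x0 d0.
by field; rewrite !gt_eqF// addr_gt0// mulr_gt0.
Qed.

Lemma continuous_tanh : continuous (@tanh R).
Proof.
move=> u; rewrite /continuous_at /tanh.
have cN : {for u, continuous (fun v : R => expR (- v))}.
  by apply: continuous_comp; [exact: opp_continuous|exact: continuous_expR].
apply: cvgM.
  by apply: cvgB; [exact: continuous_expR|exact: cN].
apply: cvgV; first by rewrite gt_eqF// tanh_den_gt0.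
by apply: cvgD; [exact: continuous_expR|exact: cN].
Qed.

Lemma continuous_sum (I : Type) (r : seq I) (F : I -> R -> R) :
  (forall i, continuous (F i)) -> continuous (fun c => \sum_(i <- r) F i c).
Proof.
move=> cF; elim: r => [|i r IH] c.
  by under eq_fun do rewrite big_nil; exact: cvg_cst.
by under eq_fun do rewrite big_cons; apply: cvgD; [exact: cF|exact: IH].
Qed.

End Tanh.

(** * Local fields *)

Section Interaction.
Context {R : realType} (p N : nat) (J : tensor p N R).
Hypothesis p2 : (2 <= p)%N.
Hypothesis N0 : (0 < N)%N.
Hypothesis symJ : symmetric_tensor J.
Hypothesis diagJ : forall t : p.-tuple 'I_N, ~~ uniq t -> J t = 0.
Hypothesis boundJ : forall t, `|J t| <= (N%:R ^+ p.-1)^-1.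

Let NR : 0 < N%:R :> R. Proof. by rewrite ltr0n. Qed.
Let l0 : 'I_p := Ordinal (ltnW p2).

Definition flip (x : config N) (i : 'I_N) : config N :=
  [ffun j => if j == i then ~~ x j else x j].

Lemma flipK i : involutive (fun x => flip x i).
Proof. by move=> x; apply/ffunP => j; rewrite !ffunE; case: eqP => // _; rewrite negbK. Qed.

Lemma spin_flip x i j : spin (flip x i) j = (if j == i then -1 else 1) * spin x j :> R.
Proof. by rewrite /spin ffunE; case: eqP => _; case: (x j) => /=; lra. Qed.

Lemma prod_spin_flip x i (s : seq 'I_N) : uniq s ->
  \prod_(k <- s) spin (flip x i) k =
  (if i \in s then -1 else 1) * \prod_(k <- s) spin x k :> R.
Proof.
move=> us; rewrite (eq_bigr _ (fun k _ => spin_flip x i k)) big_split/=; congr (_ * _).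
rewrite big_uniq//=; case: ifP => is_.
  by rewrite (bigD1 i)//= eqxx big1 ?mulr1// => j /andP[_ /negbTE->].
by rewrite big1// => j js; case: eqP => // ji; rewrite -ji js in is_.
Qed.

Lemma ohead_tnth (t : p.-tuple 'I_N) i : (ohead t == Some i) = (tnth t l0 == i).
Proof.
rewrite (tnth_nth i); case: t => -[|a s] /= ts; last by [].
by exfalso; move: ts p2 => /eqP <-.
Qed.

Lemma local_fieldE x i : local_field J x i =
  \sum_(t : p.-tuple 'I_N | tnth t l0 == i) J t * \prod_(k <- behead t) spin x k.
Proof. by apply: eq_bigl => t; rewrite ohead_tnth. Qed.

Lemma prod_head (x : config N) (t : p.-tuple 'I_N) :
  \prod_(k <- t) spin x k = spin x (tnth t l0) * \prod_(k <- behead t) spin x k :> R.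
Proof.
case: t => -[|a s] /= ts; first by exfalso; move: ts p2 => /eqP <-.
by rewrite big_cons (tnth_nth a).
Qed.

Lemma head_notin_behead (t : p.-tuple 'I_N) i : uniq t -> tnth t l0 = i -> i \notin behead t.
Proof.
case: t => -[|a s] /= ts; first by exfalso; move: ts p2 => /eqP <-.
by move=> /andP[aS _]; rewrite (tnth_nth a)/= => <-.
Qed.

Lemma hamiltonian_local_field x :
  hamiltonian J x = \sum_i spin x i * local_field J x i.
Proof.
rewrite /hamiltonian (partition_big (fun t : p.-tuple 'I_N => tnth t l0) predT)//=.
apply: eq_bigr => i _; rewrite local_fieldE mulr_sumr; apply: eq_bigr => t /eqP ti.
by rewrite prod_head ti mulrCA.
Qed.

Lemma local_field_flip x i : local_field J (flip x i) i = local_field J x i.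
Proof.
rewrite !local_fieldE; apply: eq_bigr => t /eqP ti.
case: (boolP (uniq t)) => [ut|/diagJ->]; last by rewrite !mul0r.
rewrite prod_spin_flip ?(negbTE (head_notin_behead ut ti)) ?mul1r//.
by case: (t) ut => -[|a s] //= _ /andP[].
Qed.

(** By symmetry, the position occupied by a given vertex does not matter. *)
Lemma sum_position (F : p.-tuple 'I_N -> R) (l : 'I_p) i :
  (forall s t : p.-tuple 'I_N, perm_eq s t -> F s = F t) ->
  \sum_(t : p.-tuple 'I_N | tnth t l == i) F t =
  \sum_(t : p.-tuple 'I_N | tnth t l0 == i) F t.
Proof.
move=> symF; pose h (t : p.-tuple 'I_N) := [tuple tnth t (tperm l0 l j) | j < p].
have hK : involutive h.
  by move=> t; apply: eq_from_tnth => j; rewrite !tnth_mktuple tpermK.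
rewrite (reindex_inj (inv_inj hK))/=; apply: eq_big => [t|t _].
  by rewrite tnth_mktuple tpermR.
by apply: symF; apply/tuple_permP; exists (tperm l0 l).
Qed.

(** The terms that contain [i] sum to [p] times [spin x i * local_field J x i]: in a
    tuple without repetition [i] occupies one of [p] positions, all equivalent. *)
Lemma hamiltonian_flip x i :
  hamiltonian J (flip x i) = hamiltonian J x - 2 * (p%:R * (spin x i * local_field J x i)).
Proof.
pose F (t : p.-tuple 'I_N) := J t * \prod_(k <- t) spin x k.
have symF (s t : p.-tuple 'I_N) : perm_eq s t -> F s = F t.
  by move=> st; rewrite /F (symJ st) (perm_big t st).
suff H : \sum_(t : p.-tuple 'I_N) (i \in (t : seq 'I_N))%:R * F t = p%:R * (spin x i * local_field J x i).
  rewrite -H mulr_sumr /hamiltonian -sumrB; apply: eq_bigr => t _.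
  case: (boolP (uniq t)) => [ut|nut]; last by rewrite /F (diagJ nut) !mul0r !mulr0 subrr.
  by rewrite prod_spin_flip// /F; case: (i \in _) => /=; ring.
transitivity (\sum_(t : p.-tuple 'I_N) \sum_(l < p) (tnth t l == i)%:R * F t).
  apply: eq_bigr => t _; rewrite -mulr_suml.
  case: (boolP (uniq t)) => [ut|nut]; last by rewrite /F (diagJ nut) mul0r !mulr0.
  congr (_ * _); case: (boolP (i \in _)) => [/tnthP[l ->]|it].
    rewrite (bigD1 l)//= eqxx big1 ?addr0// => m ml.
    by rewrite (inj_eq (tuple_uniqP _ ut)) (negbTE ml).
  rewrite big1// => l _; case: eqP => // tl.
  by rewrite -tl mem_tnth in it.
rewrite exchange_big/=.
rewrite (eq_bigr (fun _ : 'I_p => spin x i * local_field J x i)).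
  by rewrite sumr_const card_ord mulr_natl.
move=> l _; transitivity (\sum_(t : p.-tuple 'I_N | tnth t l == i) F t).
  by rewrite [RHS]big_mkcond/=; apply: eq_bigr => t _; case: eqP; rewrite ?mul1r ?mul0r.
rewrite (sum_position _ _ symF) local_fieldE mulr_sumr; apply: eq_bigr => t /eqP ti.
by rewrite /F prod_head ti mulrCA.
Qed.

Lemma card_position (l m : 'I_p) (i j : 'I_N) : l != m ->
  \sum_(t : p.-tuple 'I_N | (tnth t l == i) && (tnth t m == j)) 1 = N%:R ^+ p.-2 :> R.
Proof.
move=> lm; pose F (q : 'I_p) (k : 'I_N) : R :=
  if q == l then (k == i)%:R else if q == m then (k == j)%:R else 1.
have ml : m != l by rewrite eq_sym.
have one (k : 'I_N) : \sum_(v < N) (v == k)%:R = 1 :> R.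
  by rewrite (bigD1 k)//= eqxx big1 ?addr0// => v /negbTE->.
transitivity (\sum_(t : p.-tuple 'I_N) \prod_(q < p) F q (tnth t q)).
  rewrite big_mkcond/=; apply: eq_bigr => t _.
  rewrite (bigD1 l)//= (bigD1 m ml)//= /F eqxx (eq_sym m) (negbTE lm) eqxx.
  rewrite big1 ?mulr1; last by move=> q /andP[/negbTE-> /negbTE->].
  by case: (tnth t l == i); case: (tnth t m == j); rewrite /= ?mulr1 ?mulr0.
rewrite sum_tuple_prod (bigD1 l)//= (bigD1 m ml)//= /F eqxx (eq_sym m) (negbTE lm) eqxx.
rewrite !one !mul1r (eq_bigr (fun=> N%:R)).
  rewrite prodr_const; congr (_ ^+ _).
  have := cardC [pred q : 'I_p | (q != l) && (q != m)].
  have -> : #|predC [pred q : 'I_p | (q != l) && (q != m)]| = 2%N.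
    rewrite -[RHS](_ : #|[set l; m]%SET| = 2)%N; last by rewrite cards2 lm.
    by apply: eq_card => q; rewrite !inE negb_and !negbK.
  rewrite card_ord => E; rewrite -[in RHS]E addn2; apply: eq_card => q; rewrite !inE//.
move=> q /andP[/negbTE-> /negbTE->].
by rewrite sumr_const card_ord.
Qed.

Lemma card_head (i : 'I_N) :
  \sum_(t : p.-tuple 'I_N | tnth t l0 == i) 1 = N%:R ^+ p.-1 :> R.
Proof.
pose l1 : 'I_p := Ordinal p2.
rewrite (partition_big (fun t : p.-tuple 'I_N => tnth t l1) predT)//=.
rewrite (eq_bigr (fun=> N%:R ^+ p.-2)); last by move=> j _; rewrite card_position.
by rewrite sumr_const card_ord -[LHS]mulr_natl -exprS prednK//; lia.
Qed.

Lemma norm_local_field_le1 x i : `|local_field J x i| <= 1.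
Proof.
rewrite local_fieldE; apply: le_trans (ler_norm_sum _ _ _) _.
apply: (@le_trans _ _ (\sum_(t : p.-tuple 'I_N | tnth t l0 == i) (N%:R ^+ p.-1)^-1 * 1)).
  apply: ler_sum => t _; rewrite normrM; apply: ler_pM => //.
  by apply: norm_prod_le1 => k; rewrite norm_spin.
by rewrite -mulr_sumr card_head mulVf// expf_neq0// gt_eqF.
Qed.

(** A flip at [i] changes the terms of the field at [j] that contain [i], which are at
    most [p * N^(p-2)] in number. *)
Lemma local_field_flip_le x i j : j != i ->
  `|local_field J x j - local_field J (flip x i) j| <= 2 * p%:R / N%:R.
Proof.
move=> ji; rewrite !local_fieldE -sumrB; apply: le_trans (ler_norm_sum _ _ _) _.
pose c : R := (N%:R ^+ p.-1)^-1.
have c0 : 0 <= c by rewrite invr_ge0 exprn_ge0.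
apply: (@le_trans _ _ (\sum_(t : p.-tuple 'I_N | tnth t l0 == j)
   \sum_(l < p | l != l0) (2 * c) * (tnth t l == i)%:R)).
  apply: ler_sum => t /eqP tj.
  have pos : 0 <= \sum_(l < p | l != l0) (2 * c) * (tnth t l == i)%:R.
    by apply: sumr_ge0 => l _; rewrite !mulr_ge0.
  case: (boolP (uniq t)) => [ut|/diagJ->]; last by rewrite !mul0r subrr normr0.
  have ub : uniq (behead t) by case: (t) ut => -[|a s] //= _ /andP[].
  rewrite prod_spin_flip//; case: ifP => ib; last by rewrite mul1r subrr normr0.
  have [l tl] : exists l, tnth t l = i.
    by have /tnthP[l ->] := mem_behead ib; exists l.
  have ll0 : l != l0 by apply: contra ji => /eqP le; rewrite -tj -tl le.
  rewrite (bigD1 l)//= tl eqxx mulr1; apply: (@le_trans _ _ (2 * c)).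
    rewrite (_ : _ - _ = 2 * (J t * \prod_(k <- behead t) spin x k)); last by ring.
    rewrite normrM (ger0_norm (ler0n _ 2)) ler_wpM2l// normrM -[leRHS]mulr1.
    apply: ler_pM => //.
    by apply: norm_prod_le1 => k; rewrite norm_spin.
  by rewrite lerDl; apply: sumr_ge0 => m _; rewrite !mulr_ge0.
rewrite exchange_big/=.
apply: (@le_trans _ _ (\sum_(l < p | l != l0) 2 / N%:R)).
  apply: ler_sum => l ll0; rewrite -mulr_sumr.
  have -> : \sum_(t : p.-tuple 'I_N | tnth t l0 == j) (tnth t l == i)%:R = N%:R ^+ p.-2 :> R.
    rewrite -(@card_position l0 l j i); last by rewrite eq_sym.
    by rewrite big_mkcondr/=; apply: eq_bigr => t _; case: (tnth t l == i).
  rewrite -mulrA ler_wpM2l// /c; have -> : p.-1 = p.-2.+1 by lia.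
  by rewrite exprS invfM -mulrA mulVf ?mulr1// expf_neq0// gt_eqF.
rewrite sumr_const -[X in X <= _]mulr_natr mulrAC ler_wpM2r ?invr_ge0 ?(ltW NR)//.
rewrite ler_wpM2l// ler_nat -[leqRHS]card_ord; exact: max_card.
Qed.

End Interaction.

(** * The pseudo-likelihood score *)

Section IsingMeasure.
Context {R : realType} (p N : nat) (J : tensor p N R).
Implicit Types (beta : R) (x : config N).

Lemma partition_funE beta :
  partition_fun J beta = unif_mean (fun x => expR (beta * hamiltonian J x)).
Proof. by []. Qed.

Lemma sum_expR_gt0 beta : 0 < \sum_(x : config N) expR (beta * hamiltonian J x).
Proof.
rewrite (bigD1 ([ffun=> true] : config N))//=; apply: ltr_wpDr; last exact: expR_gt0.
by apply: sumr_ge0 => x _; apply: expR_ge0.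
Qed.

Lemma partition_fun_gt0 beta : 0 < partition_fun J beta.
Proof. by rewrite mulr_gt0 ?invr_gt0 ?exprn_gt0// sum_expR_gt0. Qed.

Lemma ising_pmfE beta x : ising_pmf J beta x =
  2 ^- N * (expR (beta * hamiltonian J x) / partition_fun J beta).
Proof. by rewrite /ising_pmf invfM mulrCA. Qed.

Lemma ising_pmf_ge0 beta x : 0 <= ising_pmf J beta x.
Proof.
rewrite /ising_pmf divr_ge0 ?expR_ge0// mulr_ge0 ?exprn_ge0//.
exact: ltW (partition_fun_gt0 _).
Qed.

Lemma ising_pmf_sum beta : \sum_x ising_pmf J beta x = 1.
Proof.
rewrite /ising_pmf -mulr_suml mulrA mulfV ?mul1r ?expf_neq0//.
by rewrite mulfV// gt_eqF// sum_expR_gt0.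
Qed.

Lemma ising_prob_le beta (A B : {set config N}) : A \subset B ->
  ising_prob J beta A <= ising_prob J beta B.
Proof.
move=> AB; rewrite /ising_prob big_mkcond [leRHS]big_mkcond/=; apply: ler_sum => x _.
case: ifP => xA; first by rewrite (fintype.subsetP AB _ xA).
by case: ifP => _ //; apply: ising_pmf_ge0.
Qed.

Lemma ising_prob_ge0 beta (A : {set config N}) : 0 <= ising_prob J beta A.
Proof. by apply: sumr_ge0 => x _; apply: ising_pmf_ge0. Qed.

Lemma ising_probC beta (A : {set config N}) :
  ising_prob J beta (~: A) = 1 - ising_prob J beta A.
Proof.
rewrite -(ising_pmf_sum beta) (bigID (mem A))/= addrC addrK.
by apply: eq_bigl => x; rewrite inE.
Qed.

Lemma ising_probU_le beta (A B : {set config N}) :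
  ising_prob J beta (A :|: B) <= ising_prob J beta A + ising_prob J beta B.
Proof.
rewrite /ising_prob big_mkcond [X in _ <= X + _]big_mkcond [X in _ <= _ + X]big_mkcond -big_split/=; apply: ler_sum => x _.
have := ising_pmf_ge0 beta x.
by rewrite inE; case: (x \in A); case: (x \in B) => /=; lra.
Qed.

Lemma ising_prob_markov beta (f : config N -> R) (a : R) : 0 < a ->
  (forall x, 0 <= f x) ->
  ising_prob J beta [set x | a < f x]%SET <= (\sum_x ising_pmf J beta x * f x) / a.
Proof.
move=> a0 f0; rewrite ler_pdivlMr// /ising_prob big_mkcond mulr_suml/=.
apply: ler_sum => x _; rewrite inE; case: ifP => ax.
  by rewrite ler_wpM2l ?ising_pmf_ge0// ltW.
by rewrite mul0r mulr_ge0// ising_pmf_ge0.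
Qed.

(** On this event the Boltzmann weight is at most [expR (beta * e)]. *)
Lemma small_hamiltonian_prob beta e : 0 <= beta ->
  ising_prob J beta [set x | hamiltonian J x <= e]%SET
    <= expR (beta * e) / partition_fun J beta.
Proof.
move=> b0; have Z0 := partition_fun_gt0 beta.
rewrite /ising_prob; apply: (@le_trans _ _ (\sum_(x : config N)
   2 ^- N * (expR (beta * e) / partition_fun J beta))).
  rewrite big_mkcond/=; apply: ler_sum => x _; rewrite inE; case: ifP => H.
    rewrite ising_pmfE ler_wpM2l ?invr_ge0 ?exprn_ge0// ler_wpM2r ?invr_ge0 ?(ltW Z0)//.
    by rewrite ler_expR ler_wpM2l.
  by rewrite mulr_ge0 ?invr_ge0 ?exprn_ge0// divr_ge0 ?expR_ge0// ltW.
rewrite -mulr_sumr -[X in X <= _]/(unif_mean (fun _ : config N => _ / _)).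
by rewrite unif_mean_cst.
Qed.

End IsingMeasure.

Section PseudoScore.
Context {R : realType} (p N : nat) (J : tensor p N R).
Hypothesis p2 : (2 <= p)%N.
Hypothesis N0 : (0 < N)%N.
Hypothesis symJ : symmetric_tensor J.
Hypothesis diagJ : forall t : p.-tuple 'I_N, ~~ uniq t -> J t = 0.
Hypothesis boundJ : forall t, `|J t| <= (N%:R ^+ p.-1)^-1.

Let NR : 0 < N%:R :> R. Proof. by rewrite ltr0n. Qed.
Local Notation m := (local_field J).

(** The spin minus its conditional mean given the other spins. *)
Definition residual (b : R) (x : config N) (i : 'I_N) : R :=
  spin x i - tanh (p%:R * b * m x i).

(** The derivative of the log-pseudo-likelihood, up to a factor [p]; [mpl] is its
    smallest nonnegative root. *)
Definition pseudo_score (b : R) (x : config N) : R :=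
  \sum_i m x i * residual b x i.

Definition flip_bound (b : R) : R := 4 + (2 + 4 * (p%:R * b)) * (2 * p%:R).

Lemma pseudo_scoreE b x : pseudo_score b x =
  hamiltonian J x - \sum_i m x i * tanh (p%:R * b * m x i).
Proof.
rewrite (hamiltonian_local_field J p2) -sumrB; apply: eq_bigr => i _.
by rewrite /residual mulrBr [m x i * spin _ _]mulrC.
Qed.

Lemma norm_residual b x i : `|residual b x i| <= 2.
Proof.
apply: le_trans (ler_normB _ _) _; rewrite norm_spin.
by have := norm_tanh_le1 (p%:R * b * m x i); lra.
Qed.

(** The residual has conditional mean zero given the other spins. *)
Lemma residual_flip b x i :
  ising_pmf J b x * residual b x i +
  ising_pmf J b (flip x i) * residual b (flip x i) i = 0.
Proof.
rewrite /residual local_field_flip// !ising_pmfE spin_flip eqxx mulN1r.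
rewrite (hamiltonian_flip p2 symJ diagJ) tanh_flip ?norm_spin//.
rewrite [b * (_ - _)]mulrBr expRD.
rewrite (_ : - (b * (2 * (p%:R * (spin x i * m x i)))) = - (2 * (spin x i * (p%:R * b * m x i)))); last by ring.
by ring.
Qed.

(** The own term of [i] changes by a bounded amount, each of the [N] others by
    [O(1 / N)]. *)
Lemma pseudo_score_flip b x i : 0 <= b ->
  `|pseudo_score b x - pseudo_score b (flip x i)| <= flip_bound b.
Proof.
move=> b0; rewrite /pseudo_score -sumrB (bigD1 i)//=.
have m1 := norm_local_field_le1 p2 N0 boundJ.
apply: le_trans (ler_normD _ _) _; rewrite /flip_bound; apply: lerD.
  rewrite local_field_flip// -mulrBr normrM.
  have H : `|residual b x i - residual b (flip x i) i| <= 4.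
    apply: le_trans (ler_normB _ _) _.
    by have := norm_residual b x i; have := norm_residual b (flip x i) i; lra.
  by rewrite -[leRHS]mul1r; apply: ler_pM.
apply: le_trans (ler_norm_sum _ _ _) _.
have pb0 : 0 <= p%:R * b by rewrite mulr_ge0.
apply: (@le_trans _ _ (\sum_(j < N | j != i) (2 + 4 * (p%:R * b)) * (2 * p%:R / N%:R))).
  apply: ler_sum => j ji.
  have D := local_field_flip_le p2 N0 diagJ boundJ x ji.
  have T := sub_tanh_le (p%:R * b * m x j) (p%:R * b * m (flip x i) j).
  rewrite -mulrBr normrM (ger0_norm pb0) in T.
  have D' := ler_wpM2l pb0 D.
  have -> : m x j * residual b x j - m (flip x i) j * residual b (flip x i) j =
    (m x j - m (flip x i) j) * residual b x j +
    m (flip x i) j * (tanh (p%:R * b * m (flip x i) j) - tanh (p%:R * b * m x j)).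
    by rewrite /residual spin_flip (negbTE ji) mul1r; ring.
  apply: le_trans (ler_normD _ _) _; rewrite !normrM mulrDl; apply: lerD.
    by rewrite mulrC; apply: ler_pM => //; apply: norm_residual.
  rewrite -[leRHS]mul1r; apply: ler_pM => //.
  by rewrite distrC; apply: le_trans T _; rewrite -[leRHS]mulrA ler_wpM2l.
rewrite sumr_const -[X in X <= _]mulr_natr -mulrA ler_wpM2l ?addr_ge0 ?mulr_ge0//.
rewrite mulrAC ler_pdivrMr// ler_wpM2l ?mulr_ge0// ler_nat -[leqRHS]card_ord.
exact: max_card.
Qed.

(** Second moment by exchangeable pairs. Expand one factor of the square over [i].
    Since [W] is antisymmetric under the flip at [i], the other factor may be replaced
    by half of its variation under that flip, which is bounded; each of the [N] terms
    is then [O(1)]. *)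
Lemma pseudo_score_sqr_mean b : 0 <= b ->
  \sum_x ising_pmf J b x * pseudo_score b x ^+ 2 <= flip_bound b * N%:R.
Proof.
move=> b0; have m1 := norm_local_field_le1 p2 N0 boundJ.
have -> : \sum_x ising_pmf J b x * pseudo_score b x ^+ 2 =
    \sum_i \sum_x ising_pmf J b x * (m x i * residual b x i) * pseudo_score b x.
  rewrite exchange_big/=; apply: eq_bigr => x _.
  by rewrite -mulr_suml -mulr_sumr -/(pseudo_score b x) expr2 mulrA.
have -> : flip_bound b * N%:R = \sum_(i < N) flip_bound b.
  by rewrite sumr_const card_ord mulr_natr.
apply: ler_sum => i _.
pose W (x : config N) := ising_pmf J b x * (m x i * residual b x i).
have anti x : W (flip x i) = - W x.
  apply/eqP; rewrite -addr_eq0 /W local_field_flip// addrC.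
  rewrite !(mulrCA (ising_pmf J b _)) -mulrDr residual_flip mulr0//.
have refl : \sum_x W x * pseudo_score b x = - \sum_x W x * pseudo_score b (flip x i).
  rewrite (reindex_inj (inv_inj (@flipK N i)))/= -sumrN; apply: eq_bigr => x _.
  by rewrite anti mulNr.
have H : 2 * \sum_x W x * pseudo_score b x =
    \sum_x W x * (pseudo_score b x - pseudo_score b (flip x i)).
  rewrite mulr_natl mulr2n {2}refl -sumrB; apply: eq_bigr => x _.
  by rewrite mulrBr.
suff : \sum_x W x * (pseudo_score b x - pseudo_score b (flip x i)) <= 2 * flip_bound b.
  by rewrite -H; lra.
apply: (@le_trans _ _ (\sum_x ising_pmf J b x * (2 * flip_bound b))); last first.
  by rewrite -mulr_suml ising_pmf_sum mul1r.
apply: ler_sum => x _; rewrite /W -mulrA ler_wpM2l ?ising_pmf_ge0//.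
apply: le_trans (ler_norm _) _; rewrite normrM; apply: ler_pM => //; last exact: pseudo_score_flip.
rewrite normrM -[leRHS]mul1r; apply: ler_pM => //; exact: norm_residual.
Qed.

(** The Hamiltonian is the inner product of the spins with the local fields; this is
    Cauchy-Schwarz in the form [2 e s m <= m^2 + e^2]. *)
Lemma sum_field_sqr_ge (e : R) x : 0 < e -> e * N%:R < hamiltonian J x ->
  e ^+ 2 * N%:R <= \sum_i m x i ^+ 2.
Proof.
move=> e0; rewrite (hamiltonian_local_field J p2) => H.
have H1 : 2 * e * \sum_i spin x i * m x i <= \sum_i (m x i ^+ 2 + e ^+ 2).
  rewrite mulr_sumr; apply: ler_sum => i _.
  have s2 := spin_sqr (R := R) x i.
  have -> : m x i ^+ 2 = (spin x i * spin x i) * m x i ^+ 2 by rewrite s2 mul1r.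
  have := sqr_ge0 (spin x i * m x i - e); nra.
rewrite big_split/= sumr_const card_ord -[X in _ + X]mulr_natr in H1.
have := ltr_pM2l e0 (e * N%:R) (\sum_i spin x i * m x i); rewrite H => H2.
nra.
Qed.

Lemma pseudo_score_gap (B b b' : R) x : 0 <= b' <= b -> p%:R * b <= B ->
  expR (- (2 * B)) ^+ 2 * (p%:R * (b - b')) * \sum_i m x i ^+ 2 <=
  pseudo_score b' x - pseudo_score b x.
Proof.
move=> /andP[b'0 b'b] bB; rewrite !pseudo_scoreE.
have E (h u v : R) : h - u - (h - v) = v - u by ring.
rewrite E -sumrB mulr_sumr; apply: ler_sum => i _.
have m1 := norm_local_field_le1 p2 N0 boundJ x i.
have := @mul_tanh_ge R B (p%:R * b) (p%:R * b') (m x i).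
rewrite -mulrBr mulr_ge0//= ler_wpM2l//; exact.
Qed.

(** The score has slope at most [- r * p * eta * N] on [[0, b + 1]] and size at most
    [A * sqrt N] at [b]. It is therefore positive up to [b - M / sqrt N] and negative
    at [b + M / sqrt N], so that its first root lies in between. *)
Lemma mpl_close (b eta A : R) x : 0 < b -> 0 < eta -> 0 <= A ->
  let M := (A + 1) / (expR (- (2 * (p%:R * (b + 1)))) ^+ 2 * p%:R * eta) in
  M / Num.sqrt N%:R <= b -> M / Num.sqrt N%:R <= 1 ->
  eta * N%:R <= \sum_i m x i ^+ 2 ->
  `|pseudo_score b x| <= A * Num.sqrt N%:R ->
  ((Num.sqrt N%:R)%:E * `|mpl J x - b%:E| <= M%:E)%E.
Proof.
move=> b0 eta0 A0; set r := expR _ ^+ 2 => M.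
have sN0 : 0 < Num.sqrt N%:R :> R by rewrite sqrtr_gt0.
have sNN : Num.sqrt N%:R * Num.sqrt N%:R = N%:R :> R by rewrite -expr2 sqr_sqrtr.
have pR : 0 < p%:R :> R by rewrite ltr0n; lia.
have r0 : 0 < r by rewrite exprn_gt0// expR_gt0.
have X0 : 0 < r * p%:R * eta by apply: mulr_gt0 => //; apply: mulr_gt0.
have ME : r * p%:R * eta * M = A + 1.
  by rewrite /M mulrCA mulfV ?mulr1 ?gt_eqF.
have M0 : 0 < M by apply: divr_gt0 => //; lra.
set dl := M / Num.sqrt N%:R => dlb dl1 HS Hf.
have dl0 : 0 < dl by rewrite divr_gt0.
have gap b1 b2 : 0 <= b1 -> b1 + dl <= b2 -> b2 <= b + 1 ->
    (A + 1) * Num.sqrt N%:R <= pseudo_score b1 x - pseudo_score b2 x.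
  move=> b10 b12 b2b.
  have G := @pseudo_score_gap (p%:R * (b + 1)) b2 b1 x.
  apply: le_trans (G _ _); last 2 first.
  - by rewrite b10/=; lra.
  - by rewrite ler_wpM2l// ltW.
  rewrite -/r; apply: (@le_trans _ _ (r * (p%:R * dl) * (eta * N%:R))).
    rewrite -ME -[X in eta * X]sNN /dl le_eqVlt; apply/orP; left; apply/eqP.
    by field; rewrite gt_eqF.
  apply: ler_pM => //.
  - by rewrite mulr_ge0 ?(ltW r0)// mulr_ge0 ?ltW.
  - by rewrite mulr_ge0 ?ltW.
  - rewrite ler_wpM2l ?(ltW r0)// ler_wpM2l ?(ltW pR)//; lra.
rewrite ler_norml in Hf; case/andP: Hf => Hf1 Hf2.
have up : pseudo_score (b + dl) x < 0.
  have := gap b (b + dl) (ltW b0) (lexx _); rewrite lerD2l => /(_ dl1); nra.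
have lo b' : 0 <= b' -> b' <= b - dl -> 0 < pseudo_score b' x.
  move=> b'0 b'b; have := gap b' b b'0; rewrite lerDl ler01 => /(_ _ isT); nra.
have cont : continuous (fun c => pseudo_score c x).
  apply: continuous_sum => i c.
  apply: cvgM; first exact: cvg_cst.
  apply: cvgB; first exact: cvg_cst.
  apply: continuous_cvg; first exact: continuous_tanh.
  by apply: cvgM; [apply: cvgM; [exact: cvg_cst|exact: cvg_id]|exact: cvg_cst].
have [c cI fc] : exists2 c, c \in `[b - dl, b + dl] & pseudo_score c x = 0.
  apply: IVT; first by lra.
    exact: continuous_subspaceT.
  have l1 := lo (b - dl) ltac:(lra) (lexx _).
  by rewrite ge_min le_max (ltW up) (ltW l1) orbT.
move: cI; rewrite in_itv/= => /andP[cl cu].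
have root b' : (hamiltonian J x = \sum_i m x i * tanh (p%:R * b' * m x i)) <->
    pseudo_score b' x = 0.
  by rewrite pseudo_scoreE; split => [->|/eqP]; [rewrite subrr | rewrite subr_eq0 => /eqP].
have mu : (mpl J x <= (b + dl)%:E)%E.
  apply: (@le_trans _ _ c%:E); last by rewrite lee_fin.
  apply: ereal_inf_lbound; exists c => //=; split; last by apply/root.
  by lra.
have ml : ((b - dl)%:E <= mpl J x)%E.
  apply: le_ereal_inf_tmp => _ [b' /= [b'0 /root fb'] <-]; rewrite lee_fin leNgt; apply/negP => H.
  by have := lo b' b'0 (ltW H); rewrite fb' ltxx.
move: mu ml; case: (mpl J x) => [y||] //=; rewrite !lee_fin => yu yl.
rewrite (_ : M = Num.sqrt N%:R * dl); last by rewrite /dl mulrCA mulfV ?mulr1// gt_eqF.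
rewrite ler_wpM2l ?(ltW sN0)// ler_norml; lra.
Qed.

End PseudoScore.

(** * Consistency from growth, inconsistency from bounded partition functions *)

Section Growth.
Context {R : realType}.

(** Exponential growth of the partition function makes a Hamiltonian below [e * N]
    exponentially unlikely, hence the sum of the squared local fields is of order [N];
    the score is [O(sqrt N)] by its second moment, and [mpl_close] concludes. *)
Lemma sqrt_consistent_of_growth (p : nat) (J : forall N, tensor p N R) (b c : R) :
  (2 <= p)%N -> (forall N, symmetric_tensor (J N)) ->
  (forall N (t : p.-tuple 'I_N), ~~ uniq t -> J N t = 0) ->
  (forall N (t : p.-tuple 'I_N), `|J N t| <= (N%:R ^+ p.-1)^-1) ->
  0 < b -> 0 < c ->
  (\forall N \near \oo, expR (c * N%:R) <= partition_fun (J N) b) ->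
  sqrt_consistent J (fun N => mpl (J N)) b.
Proof.
move=> p2 symJ diagJ boundJ b0 c0 growth delta d0.
(* below [e * N] the Boltzmann weight is at most [expR (c / 2 * N)], the square root
   of the bound on the partition function *)
pose e := c / (2 * b).
have e0 : 0 < e by rewrite divr_gt0// mulr_gt0.
pose F := flip_bound p b.
have F0 : 0 < F.
  rewrite /F /flip_bound; have := ler0n R p => p0.
  by have := mulr_ge0 (mulr_ge0 p0 (ltW b0)) p0; nra.
have Fd0 : 0 < F / delta by rewrite divr_gt0.
(* large enough for Chebyshev's bound [F / A2 ^+ 2] to be below [delta / 2] *)
pose A2 := 2 * F / delta + 1.
have A20 : 1 < A2 by rewrite /A2 -mulrA; lra.
pose M := (A2 + 1) / (expR (- (2 * (p%:R * (b + 1)))) ^+ 2 * p%:R * e ^+ 2).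
have M0 : 0 < M.
  apply: divr_gt0; first by lra.
  apply: mulr_gt0; last exact: exprn_gt0.
  apply: mulr_gt0; last by rewrite ltr0n; lia.
  by rewrite exprn_gt0// expR_gt0.
exists M => //; near=> N.
have N0 : (0 < N)%N by near: N; exists 1%N.
have NR : 0 < N%:R :> R by rewrite ltr0n.
have sN0 : 0 < Num.sqrt N%:R :> R by rewrite sqrtr_gt0.
have Mb : M / Num.sqrt N%:R <= Num.min b 1.
  have mb0 : 0 < Num.min b 1 by rewrite lt_min b0 ltr01.
  rewrite ler_pdivrMr// -ler_pdivrMl//.
  rewrite -[leLHS]ger0_norm; last by rewrite mulr_ge0 ?invr_ge0 ?(ltW mb0) ?(ltW M0).
  rewrite -sqrtr_sqr ler_wsqrtr//.
  by near: N; exact: nbhs_infty_ger.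
rewrite le_min in Mb; case/andP: Mb => Mb M1.
have Z : expR (c * N%:R) <= partition_fun (J N) b by near: N.
pose H1 : {set config N} := [set x | hamiltonian (J N) x <= e * N%:R]%SET.
pose H2 : {set config N} := [set x | A2 ^+ 2 * N%:R < pseudo_score (J N) b x ^+ 2]%SET.
set good := [set x : config N | _]%SET.
have cover : ~: good \subset H1 :|: H2.
  apply/fintype.subsetP => x; rewrite !inE; apply: contraR.
  rewrite negb_or -ltNge -leNgt => /andP[h1 h2].
  apply: (@mpl_close R p N (J N) p2 N0 (@boundJ N) b (e ^+ 2) A2 x b0 _ _ Mb M1).
  - by rewrite exprn_gt0.
  - by lra.
  - exact: sum_field_sqr_ge.
  - rewrite -(@ler_pXn2r _ 2)// ?nnegrE ?normr_ge0//; last by rewrite mulr_ge0 ?(ltW sN0)//; lra.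
    by rewrite real_normK ?num_real// exprMn sqr_sqrtr.
have P1 : ising_prob (J N) b H1 <= expR (- (c / 2 * N%:R)).
  apply: le_trans (small_hamiltonian_prob _ _ (ltW b0)) _.
  rewrite ler_pdivrMr ?partition_fun_gt0//.
  apply: (@le_trans _ _ (expR (- (c / 2 * N%:R)) * expR (c * N%:R))); last first.
    by rewrite ler_wpM2l ?expR_ge0.
  rewrite -expRD ler_expR /e le_eqVlt; apply/orP; left; apply/eqP.
  by field; rewrite gt_eqF.
have P2 : ising_prob (J N) b H2 <= F / A2 ^+ 2.
  apply: le_trans (ising_prob_markov _ _ _ _) _.
  - by rewrite mulr_gt0// exprn_gt0//; lra.
  - by move=> x; exact: sqr_ge0.
  rewrite ler_pdivrMr; last by rewrite mulr_gt0// exprn_gt0//; lra.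
  apply: le_trans (pseudo_score_sqr_mean p2 N0 (@symJ N) (@diagJ N) (@boundJ N) (ltW b0)) _.
  by rewrite -[leRHS]mulrA mulKf// expf_neq0// gt_eqF//; lra.
have P3 : F / A2 ^+ 2 < delta / 2.
  have A2d : 2 * F < A2 * delta by rewrite [A2 * _]mulrDl divfK ?gt_eqF//; lra.
  rewrite ltr_pdivrMr; last by rewrite exprn_gt0//; lra.
  have : A2 * 1 <= A2 * A2 by rewrite ler_wpM2l//; lra.
  by rewrite mulr1 -expr2 => /(ler_wpM2r (ltW d0)); lra.
have P4 : expR (- (c / 2 * N%:R)) <= delta / 2.
  have : 1 + c / 2 * N%:R <= expR (c / 2 * N%:R) by apply: expR_ge1Dx.
  have : 2 / delta <= c / 2 * N%:R.
    rewrite -ler_pdivrMl ?divr_gt0//; near: N; exact: nbhs_infty_ger.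
  move=> h1 h2; rewrite expRN -[leRHS]invrK lef_pV2 ?posrE ?expR_gt0 ?invr_gt0 ?divr_gt0//.
  by rewrite invf_div; lra.
have : ising_prob (J N) b (~: good) < delta.
  apply: le_lt_trans (ising_prob_le _ _ cover) _.
  by apply: le_lt_trans (ising_probU_le _ _ _ _) _; lra.
by rewrite ising_probC; lra.
Unshelve. all: by end_near.
Qed.

End Growth.

Section Contiguity.
Context {R : realType} (p : nat).

(** A quantitative contiguity between parameters below [b1]: on [`|H| <= M] the two
    Boltzmann weights are within a factor [expR ((b + b') * M)], and beyond it the
    weight at [b'] is dominated by those at [b1] and [- b1]. *)
Lemma tilt_transfer N (J : tensor p N R) (b b' b1 C M : R) (A : {set config N}) :
  0 <= b < b1 -> 0 <= b' < b1 -> 0 <= M ->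
  unif_mean (fun x => expR (b1 * hamiltonian J x)) <= C ->
  unif_mean (fun x => expR (- b1 * hamiltonian J x)) <= C ->
  ising_prob J b' A <= (C + 1) * (expR ((b + b') * M) * (C + 1) * ising_prob J b A
     + expR (- ((b1 - b') * M)) * (2 * C)).
Proof.
move=> /andP[b0 bb1] /andP[b'0 b'b1] M0 ZC ZNC.
set H := hamiltonian J in ZC ZNC *.
have C0 : 0 <= C by apply: le_trans ZC; apply: unif_mean_ge0 => x; apply: expR_ge0.
pose W (c : R) := unif_mean (fun x => (x \in A)%:R * expR (c * H x)).
have PW c : ising_prob J c A * partition_fun J c = W c.
  rewrite /ising_prob /W /unif_mean big_mkcond mulr_suml mulr_sumr/=; apply: eq_bigr => x _.
  rewrite ising_pmfE; case: (x \in A); last by rewrite !mul0r mulr0.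
  by rewrite mul1r -mulrA divfK// gt_eqF// partition_fun_gt0.
have Zb : partition_fun J b <= C + 1.
  rewrite partition_funE; apply: (@le_trans _ _ (unif_mean (fun x => expR (b1 * H x) + 1))).
    apply: unif_mean_le => x; case: (lerP 0 (H x)) => Hx.
      rewrite ler_wpDr// ler_expR ler_wpM2r//; exact: ltW.
    rewrite ler_wpDl ?expR_ge0// -[leRHS](expR0 R) ler_expR.
    by rewrite mulr_ge0_le0// ltW.
  by rewrite unif_meanD unif_mean_cst lerD2r.
have Zb' : (C + 1)^-1 <= partition_fun J b'.
  have Cp : 0 < C + 1 by lra.
  (* [y + s^2 / y >= 2 s] turns the upper bound [1 / s] on the mean of [1 / y] into
     the lower bound [s] on that of [y] *)
  pose s := (C + 1)^-1; have s0 : 0 < s by rewrite invr_gt0.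
  apply: (@le_trans _ _ (unif_mean (fun x => 2 * s + (- s ^+ 2) * (expR (- b1 * H x) + 1)))).
    rewrite unif_meanD unif_mean_cst unif_meanZ unif_meanD unif_mean_cst.
    have : s ^+ 2 * (unif_mean (fun x => expR (- b1 * H x)) + 1) <= s ^+ 2 * (C + 1).
      by rewrite ler_wpM2l ?sqr_ge0// lerD2r.
    have -> : s ^+ 2 * (C + 1) = s by rewrite /s expr2 -mulrA mulVf ?mulr1// gt_eqF.
    by rewrite -/s; lra.
  rewrite partition_funE; apply: unif_mean_le => x.
  have h : expR (- (b' * H x)) <= expR (- b1 * H x) + 1.
    case: (lerP 0 (H x)) => Hx.
      rewrite ler_wpDl ?expR_ge0// -[leRHS](expR0 R) ler_expR oppr_le0.
      by rewrite mulr_ge0.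
    rewrite ler_wpDr// ler_expR -mulNr ler_wnM2r ?(ltW Hx)// lerN2; exact: ltW.
  have e0 := expR_gt0 (b' * H x).
  have : s ^+ 2 * expR (- (b' * H x)) <= s ^+ 2 * (expR (- b1 * H x) + 1).
    by rewrite ler_wpM2l ?sqr_ge0.
  suff : 2 * s <= expR (b' * H x) + s ^+ 2 * expR (- (b' * H x)) by lra.
  have := sqr_ge0 (expR (b' * H x) - s).
  have -> : expR (b' * H x) + s ^+ 2 * expR (- (b' * H x)) =
    (expR (b' * H x) ^+ 2 + s ^+ 2) / expR (b' * H x).
    by rewrite expRN; field; rewrite gt_eqF.
  by rewrite ler_pdivlMr//; nra.
have WW : W b' <= expR ((b + b') * M) * W b + expR (- ((b1 - b') * M)) * (2 * C).
  apply: (@le_trans _ _ (unif_mean (fun x => expR ((b + b') * M) * ((x \in A)%:R * expR (b * H x))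
      + expR (- ((b1 - b') * M)) * (expR (b1 * H x) + expR (- b1 * H x))))).
    apply: unif_mean_le => x.
    have t1 : 0 <= expR ((b + b') * M) * ((x \in A)%:R * expR (b * H x)).
      by rewrite !mulr_ge0 ?expR_ge0.
    have t2 : 0 <= expR (- ((b1 - b') * M)) * expR (b1 * H x) by rewrite mulr_ge0 ?expR_ge0.
    have t3 : 0 <= expR (- ((b1 - b') * M)) * expR (- b1 * H x) by rewrite mulr_ge0 ?expR_ge0.
    rewrite mulrDr.
    case: (lerP `|H x| M) => HM.
      suff : (x \in A)%:R * expR (b' * H x) <= expR ((b + b') * M) * ((x \in A)%:R * expR (b * H x)) by lra.
      rewrite mulrCA ler_wpM2l// -expRD ler_expR.
      rewrite ler_norml in HM; case/andP: HM => h1 h2; nra.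
    have : (x \in A)%:R * expR (b' * H x) <= expR (b' * H x).
      by rewrite ler_piMl ?expR_ge0//; case: (x \in A).
    rewrite -!expRD in t2 t3 *.
    move: HM; rewrite ltr_normr => /orP[h|h].
      have : expR (b' * H x) <= expR (- ((b1 - b') * M) + b1 * H x) by rewrite ler_expR; nra.
      by lra.
    have : expR (b' * H x) <= expR (- ((b1 - b') * M) + - b1 * H x) by rewrite ler_expR; nra.
    by lra.
  rewrite unif_meanD !unif_meanZ unif_meanD lerD2l ler_wpM2l ?expR_ge0//; lra.
have Pb' := ising_prob_ge0 J b' A; have Pb := ising_prob_ge0 J b A.
have Cp : 0 < C + 1 by lra.
rewrite -!PW in WW.
have s1 : ising_prob J b' A * (C + 1)^-1 <= ising_prob J b' A * partition_fun J b'.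
  by rewrite ler_wpM2l.
have s2 : ising_prob J b A * partition_fun J b <= ising_prob J b A * (C + 1) by rewrite ler_wpM2l.
rewrite mulrC -ler_pdivrMr//; apply: le_trans s1 _; apply: le_trans WW _.
rewrite lerD2r -mulrA ler_wpM2l ?expR_ge0// [leRHS]mulrC//.
Qed.

Lemma transfer_cvg0 (J : forall N, tensor p N R) (A : forall N, {set config N}) (b b' b1 C : R) :
  0 <= b < b1 -> 0 <= b' < b1 ->
  (\forall N \near \oo, unif_mean (fun x => expR (b1 * hamiltonian (J N) x)) <= C /\
     unif_mean (fun x => expR (- b1 * hamiltonian (J N) x)) <= C) ->
  (fun N => ising_prob (J N) b (A N)) @ \oo --> (0 : R) ->
  forall eta : R, 0 < eta -> \forall N \near \oo, ising_prob (J N) b' (A N) < eta.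
Proof.
move=> bb1 b'b1 ZC Pb0 eta eta0.
pose D : R := `|C| + 1.
have D0 : 0 < D by rewrite ltr_wpDl.
have CD : C <= D by rewrite /D; have := ler_norm C; lra.
have K0 : 0 < (D + 1) * (2 * D) by rewrite mulr_gt0//; lra.
have gap0 : 0 < b1 - b' by case/andP: b'b1; lra.
pose M := 2 * ((D + 1) * (2 * D)) / eta / (b1 - b').
have M0 : 0 < M by rewrite !divr_gt0// mulr_gt0.
have tail : (D + 1) * (2 * D) * expR (- ((b1 - b') * M)) < eta / 2.
  have -> : (b1 - b') * M = 2 * ((D + 1) * (2 * D)) / eta by rewrite /M mulrC divfK// gt_eqF.
  set K := (D + 1) * (2 * D) in K0 *.
  have := expR_ge1Dx (2 * K / eta); set q := 2 * K / eta => Hq.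
  have q0 : 0 < q by rewrite divr_gt0// mulr_gt0.
  rewrite expRN ltr_pdivrMr ?expR_gt0//.
  have -> : K = eta / 2 * q by rewrite /q; field; rewrite gt_eqF.
  by rewrite ltr_pM2l ?divr_gt0//; lra.
pose L := (D + 1) * (expR ((b + b') * M) * (D + 1)).
have L0 : 0 < L by rewrite !mulr_gt0 ?expR_gt0//; lra.
have Pn : \forall N \near \oo, `|ising_prob (J N) b (A N)| < eta / 2 / L.
  by apply: cvgr0_norm_lt => //; rewrite !divr_gt0.
near=> N.
have [Z1 Z2] : unif_mean (fun x => expR (b1 * hamiltonian (J N) x)) <= C /\
     unif_mean (fun x => expR (- b1 * hamiltonian (J N) x)) <= C by near: N.
have Pb : ising_prob (J N) b (A N) < eta / 2 / L.
  by apply: le_lt_trans (ler_norm _) _; near: N.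
apply: le_lt_trans (@tilt_transfer N (J N) b b' b1 D M (A N) bb1 b'b1 (ltW M0) (le_trans Z1 CD) (le_trans Z2 CD)) _.
rewrite ltr_pdivlMr// in Pb.
have -> : (D + 1) * (expR ((b + b') * M) * (D + 1) * ising_prob (J N) b (A N) +
   expR (- ((b1 - b') * M)) * (2 * D)) = ising_prob (J N) b (A N) * L +
   (D + 1) * (2 * D) * expR (- ((b1 - b') * M)) by rewrite /L; ring.
by lra.
Unshelve. all: by end_near.
Qed.

(** An estimator consistent at both parameters would separate the two laws by a
    sequence of events, against [transfer_cvg0]. *)
Lemma no_consistent_estimator (J : forall N, tensor p N R) (b b' b1 C : R) :
  0 <= b < b1 -> 0 <= b' < b1 -> b != b' ->
  (\forall N \near \oo, unif_mean (fun x => expR (b1 * hamiltonian (J N) x)) <= C /\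
     unif_mean (fun x => expR (- b1 * hamiltonian (J N) x)) <= C) ->
  ~ exists est : estimator_seq R, consistent J est b /\ consistent J est b'.
Proof.
move=> bb1 b'b1 bb' ZC [est [cb cb']].
pose e := `|b - b'| / 3.
have e0 : 0 < e by rewrite divr_gt0// normr_gt0 subr_eq0.
have T := transfer_cvg0 bb1 b'b1 ZC (cb e e0) (ltac:(lra) : 0 < (2^-1 : R)).
have T' := transfer_cvg0 b'b1 b'b1 ZC (cb' e e0) (ltac:(lra) : 0 < (2^-1 : R)).
have [N /= [P1 P2]] := filter_ex (filterI T T').
set A := [set x | _]%SET in P1; set A' := [set x | _]%SET in P2.
have cover : [set: config N]%SET \subset A :|: A'.
  apply/fintype.subsetP => x _; rewrite !inE.
  case: (est N x) => [y||]; rewrite ?ltry//.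
  rewrite -!EFinB !abse_EFin !lte_fin -[_ || _]negbK negb_or -!leNgt.
  apply/negP => /andP[h1 h2].
  have : `|b - b'| <= `|y - b| + `|y - b'|.
    rewrite distrC (_ : b' - b = (y - b) - (y - b')); last by ring.
    exact: ler_normB.
  have : `|b - b'| = 3 * e by rewrite /e; field.
  by lra.
have := ising_prob_le (J N) b' cover.
have -> : ising_prob (J N) b' [set: config N]%SET = 1.
  rewrite -(ising_pmf_sum (J N) b'); apply: eq_bigl => x; by rewrite inE.
have := ising_probU_le (J N) b' A A'; lra.
Qed.

End Contiguity.

(** * The threshold *)

Section ScaledAdjacency.
Context {R : realType} (p N : nat) (G : hypergraph p N).

Lemma scaled_adjacency_sym : symmetric_tensor (scaled_adjacency R G).
Proof.
move=> s t st; rewrite /scaled_adjacency /adjacency (perm_uniq st).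
have -> // : [set k in (s : seq 'I_N)]%SET = [set k in (t : seq 'I_N)]%SET.
by apply/setP => v; rewrite !inE (perm_mem st).
Qed.

Lemma scaled_adjacency_diag (t : p.-tuple 'I_N) : ~~ uniq t -> scaled_adjacency R G t = 0.
Proof. by move=> /negbTE nt; rewrite /scaled_adjacency /adjacency nt /= mul0r. Qed.

Lemma scaled_adjacency_bound (t : p.-tuple 'I_N) :
  `|scaled_adjacency R G t| <= (N%:R ^+ p.-1)^-1.
Proof.
rewrite normrM normfV [X in _ / X]ger0_norm ?exprn_ge0//.
by rewrite ler_piMl ?invr_ge0 ?exprn_ge0//; case: (adjacency G t); rewrite /= ?normr1 ?normr0.
Qed.

End ScaledAdjacency.

Section Comparison.
Context {R : realType}.

Definition exp_bounded (W : forall N, config N -> R) : Prop :=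
  forall c : R, exists C : R,
    \forall N \near \oo, unif_mean (fun x => expR (c * W N x)) <= C.

Lemma exp_bounded_nat (W : forall N, config N -> R) :
  (forall n : nat, exists C : R,
     \forall N \near \oo, unif_mean (fun x => expR (n%:R * W N x)) <= C) ->
  (forall n : nat, exists C : R,
     \forall N \near \oo, unif_mean (fun x => expR (- n%:R * W N x)) <= C) ->
  exp_bounded W.
Proof.
move=> Wp Wn c; pose n := (Num.trunc `|c|).+1.
have cn : `|c| <= n%:R by apply: ltW; rewrite -truncn_le_nat.
have [C1 H1] := Wp n; have [C2 H2] := Wn n; exists (C1 + C2).
apply: filterS2 H1 H2 => N h1 h2; apply: le_trans (lerD h1 h2).
rewrite -unif_meanD; apply: unif_mean_le => x.
have : c * W N x <= n%:R * `|W N x|.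
  by apply: le_trans (ler_norm _) _; rewrite normrM ler_wpM2r.
rewrite -ler_expR => /le_trans; apply.
case: (ger0P (W N x)) => _; first by rewrite lerDl expR_ge0.
by rewrite mulrN -mulNr lerDr expR_ge0.
Qed.

(** Young's inequality with the conjugate weights [b / b1] and [1 - b / b1]: the
    perturbation [W] costs only the margin between [b] and [b1]. *)
Lemma exp_mean_perturb (U W : forall N, config N -> R) (b b1 C : R) (c : R) :
  0 <= b < b1 -> `|c| = b -> exp_bounded W ->
  (\forall N \near \oo, unif_mean (fun x => expR (b1 * `|U N x|)) <= C) ->
  exists D : R, \forall N \near \oo,
    unif_mean (fun x => expR (c * (U N x + W N x))) <= D.
Proof.
move=> /andP[b0 bb1] cb WB UB; pose a := b / b1.
have b10 : 0 < b1 by lra.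
have a01 : 0 <= a <= 1 by rewrite divr_ge0 ?(ltW b10)//= ler_pdivrMr// mul1r ltW.
have a1 : 0 < 1 - a by rewrite subr_gt0 ltr_pdivrMr// mul1r.
have [C' HW] := WB (c / (1 - a)); exists (a * C + (1 - a) * C').
apply: filterS2 UB HW => N hU hW; case/andP: (a01) => a0 a1'.
apply: le_trans (lerD (ler_wpM2l a0 hU) (ler_wpM2l (ltW a1) hW)).
rewrite -!unif_meanZ -unif_meanD; apply: unif_mean_le => x.
apply: le_trans (expR_young _ _ a01); rewrite ler_expR mulrDr; apply: lerD.
  rewrite mulrA /a divfK ?gt_eqF// -cb -normrM; exact: ler_norm.
by rewrite mulrA [(1 - a) * _]mulrC divfK// gt_eqF.
Qed.

(** The inequality of [exp_mean_perturb] used backwards, to recover the growth of the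
    perturbed mean at [b] from that of the unperturbed one at [b1 < b]. *)
Lemma exp_mean_growth (U W : forall N, config N -> R) (b b1 eta C : R) :
  0 <= b1 < b -> 0 < eta -> exp_bounded W ->
  (\forall N \near \oo, expR (N%:R * eta - C) <= unif_mean (fun x => expR (b1 * U N x))) ->
  \forall N \near \oo,
    expR (eta / 2 * N%:R) <= unif_mean (fun x => expR (b * (U N x + W N x))).
Proof.
move=> /andP[b10 b1b] eta0 WB UB; pose a := b1 / b.
have b0 : 0 < b by lra.
have a01 : 0 <= a <= 1 by rewrite divr_ge0 ?(ltW b0)//= ler_pdivrMr// mul1r ltW.
have a1 : 0 < 1 - a by rewrite subr_gt0 ltr_pdivrMr// mul1r.
have [C' HW] := WB (- b1 / (1 - a)).
pose D := expR C * (1 + `|C'|).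
have D0 : 0 < D by rewrite mulr_gt0 ?expR_gt0//; have := normr_ge0 C'; lra.
near=> N.
have hU : expR (N%:R * eta - C) <= unif_mean (fun x => expR (b1 * U N x)) by near: N.
have hW : unif_mean (fun x => expR (- b1 / (1 - a) * W N x)) <= C' by near: N.
set Z := unif_mean (fun x => expR (b * _)).
have Z0 : 0 <= Z by apply: unif_mean_ge0 => x; apply: expR_ge0.
have H : unif_mean (fun x => expR (b1 * U N x)) <= a * Z + (1 - a) * C'.
  apply: le_trans (lerD (lexx _) (ler_wpM2l (ltW a1) hW)).
  rewrite -!unif_meanZ -unif_meanD; apply: unif_mean_le => x.
  apply: le_trans (expR_young _ _ a01); rewrite ler_expR.
  rewrite mulrA /a divfK ?gt_eqF// mulrA [(1 - a) * _]mulrC divfK ?gt_eqF//; lra.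
have big : D <= eta / 2 * N%:R.
  rewrite -ler_pdivrMl ?divr_gt0//; near: N; exact: nbhs_infty_ger.
have e1 : 1 + eta / 2 * N%:R <= expR (eta / 2 * N%:R) by apply: expR_ge1Dx.
have E : expR (N%:R * eta - C) = expR (eta / 2 * N%:R) * (expR (eta / 2 * N%:R) * expR (- C)).
  by rewrite -!expRD; congr expR; field.
have h1 : 1 + `|C'| <= expR (eta / 2 * N%:R) * expR (- C).
  rewrite expRN ler_pdivlMr ?expR_gt0// mulrC -/D; lra.
have h2 : expR (eta / 2 * N%:R) * (1 + `|C'|) <= expR (N%:R * eta - C).
  by rewrite E ler_wpM2l ?expR_ge0.
have h3 : a * Z <= Z by case/andP: a01 => ? ?; rewrite ler_piMl.
have h4 : (1 - a) * C' <= `|C'|.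
  apply: le_trans (ler_norm _) _; rewrite normrM ler_piMl//.
  by case/andP: a01 => ? ?; rewrite ger0_norm; lra.
have h5 : `|C'| <= expR (eta / 2 * N%:R) * `|C'|.
  rewrite ler_peMl//; apply: le_trans e1; rewrite lerDl; lra.
rewrite mulrDr mulr1 in h2; lra.
Unshelve. all: by end_near.
Qed.

End Comparison.

Section Threshold.
Context {R : realType} (p K : nat) (lambda : 'I_K -> R) (Theta : tensor p K R).
Hypothesis p2 : (2 <= p)%N.
Hypothesis lambda_prop : proportion_vector lambda.

Let T := hsbm_threshold lambda Theta.
Let box (t : 'I_K -> R) := forall k, 0 <= t k <= 1.

Lemma hsbm_phi0 b : hsbm_phi lambda Theta b (fun=> 0) = 0.
Proof.
rewrite /hsbm_phi !big1 ?mulr0 ?subr0//.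
  by move=> k _; rewrite /rate_fun addr0 subr0 ln1 !mulr0 addr0 !mulr0.
move=> j _; rewrite big_tuple_tnth (bigD1 (Ordinal (ltnW p2)))//=.
by rewrite mulr0 mul0r mulr0.
Qed.

(** The functional vanishes at [t = 0], so that its supremum is zero exactly when it
    is nonpositive. *)
Lemma hsbm_sup0P b :
  ereal_sup [set (hsbm_phi lambda Theta b t)%:E | t in [set t | box t]] = 0%E <->
  forall t, box t -> hsbm_phi lambda Theta b t <= 0.
Proof.
split=> [S0 t bt|H].
  rewrite -lee_fin -[leRHS]S0; apply: ereal_sup_ubound; by exists t.
apply/eqP; rewrite eq_le; apply/andP; split.
  by apply: ge_ereal_sup => _ [t bt <-]; rewrite lee_fin; apply: H.
apply: ereal_sup_ubound; exists (fun=> 0); last by rewrite hsbm_phi0.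
by move=> k; rewrite lexx ler01.
Qed.

Lemma threshold_ge0 : (0%E <= T)%E.
Proof.
apply: ereal_sup_ubound; exists 0 => //; split => //; apply/hsbm_sup0P => t bt.
rewrite /hsbm_phi mul0r sub0r oppr_le0; apply: sumr_ge0 => k _.
apply: mulr_ge0; first by case: lambda_prop.
by have /andP[t0 t1] := bt k; apply: rate_fun_ge0; rewrite ger0_norm.
Qed.

Lemma above_threshold b : (T < b%:E)%E ->
  exists b1 t, [/\ 0 <= b1 < b, box t & 0 < hsbm_phi lambda Theta b1 t].
Proof.
move=> Tb; have T0 := threshold_ge0.
have Tfin : T \is a fin_num.
  by rewrite ge0_fin_numE// (lt_trans Tb)// ltry.
have TE : T = (fine T)%:E by rewrite fineK.
rewrite TE lte_fin in Tb; rewrite TE lee_fin in T0.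
pose b1 := (fine T + b) / 2; exists b1.
have b10 : 0 <= b1 < b by rewrite /b1; lra.
apply: contrapT => H.
have : (b1%:E <= T)%E.
  apply: ereal_sup_ubound; exists b1 => //; split; first by case/andP: b10.
  apply/hsbm_sup0P => t bt; rewrite leNgt; apply/negP => pt.
  by apply: H; exists t.
by rewrite TE lee_fin /b1; lra.
Qed.

Lemma below_threshold b : (b%:E < T)%E ->
  exists2 b1, b < b1 & forall t, box t -> hsbm_phi lambda Theta b1 t <= 0.
Proof.
move=> /ereal_sup_gt[_ [b1 [b10 /hsbm_sup0P H] <-]]; rewrite lte_fin => bb1.
by exists b1.
Qed.

End Threshold.

(** * Proof of the theorem *)

Theorem theorem2p10 (R : realType) (d : measure_display)
    (Omega : measurableType d) (P : probability Omega R)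
    (p K : nat) (lambda : 'I_K -> R) (Theta : tensor p K R)
    (G : forall N : nat, Omega -> hypergraph p N) :
  (2 <= p)%N -> (1 <= K)%N ->
  proportion_vector lambda ->
  symmetric_tensor Theta ->
  (forall j, 0 <= Theta j <= 1) ->
  (forall N : nat, (1 <= N)%N -> is_HSBM P lambda Theta (G N)) ->
  {ae P, forall w : Omega,
    let J := fun N : nat => scaled_adjacency R (G N w) in
    (forall beta : R, 0 <= beta ->
       (hsbm_threshold lambda Theta < beta%:E)%E ->
       sqrt_consistent J (fun N => mpl (J N)) beta) /\
    (forall beta beta' : R, 0 <= beta -> 0 <= beta' -> beta != beta' ->
       (beta%:E < hsbm_threshold lambda Theta)%E ->
       (beta'%:E < hsbm_threshold lambda Theta)%E ->
       ~ exists est : estimator_seq R,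
           consistent J est beta /\ consistent J est beta')}.
Proof.
case: K lambda Theta => [|K] lambda Theta // p2 _ lambda_prop symT Theta01 GP.
pose blk N := @assign R K lambda N.
have bal N : balanced lambda (@blk N) by apply: assign_balanced.
have blkP N (v : 'I_N) : v \in block lambda N (blk N v) by rewrite mem_assign.
pose W w N (x : config N) := fluctuation Theta (@blk N) (scaled_adjacency R (G N w)) x.
have HW c := fluctuation_ae p2 symT Theta01 GP blkP c.
have Wp (n : nat) : {ae P, forall w, exists C : R,
     \forall N \near \oo, unif_mean (fun x => expR (n%:R * W w N x)) <= C}.
  by have [C HC] := HW n%:R; apply: filterS HC => w Hw; exists C.
have Wn (n : nat) : {ae P, forall w, exists C : R,
     \forall N \near \oo, unif_mean (fun x => expR (- n%:R * W w N x)) <= C}.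
  by have [C HC] := HW (- n%:R); apply: filterS HC => w Hw; exists C.
apply: filterS2 (ae_foralln Wp) (ae_foralln Wn) => w {Wp Wn}Wp Wn.
pose J N := scaled_adjacency R (G N w).
have WB : exp_bounded (W w) by apply: exp_bounded_nat.
pose U N (x : config N) := hamiltonian (mean_tensor Theta (@blk N)) x.
have JE N x : hamiltonian (J N) x = U N x + W w N x by rewrite addrC subrK.
split=> [b b0 Tb|b b' b0 b'0 bb' bT b'T].
- have [b1 [t [b1b t01 phit]]] := above_threshold p2 lambda_prop Tb.
  have b10 : 0 <= b1 by case/andP: b1b.
  have bpos : 0 < b by case/andP: b1b => ? ?; lra.
  apply: (@sqrt_consistent_of_growth R p J b (hsbm_phi lambda Theta b1 t / 2)) => //.
  + by move=> N; apply: scaled_adjacency_sym.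
  + by move=> N; apply: scaled_adjacency_diag.
  + by move=> N; apply: scaled_adjacency_bound.
  + by rewrite divr_gt0.
  have := @exp_mean_growth R U (W w) b b1 _ (b1 * energy_error p K.+1 + K.+1%:R) b1b phit WB.
  have lower : \forall N \near \oo, expR (N%:R * hsbm_phi lambda Theta b1 t -
      (b1 * energy_error p K.+1 + K.+1%:R)) <= unif_mean (fun x => expR (b1 * U N x)).
    by exists 1%N => // N /= N1; apply: mean_field_lower.
  move=> /(_ lower); apply: filterS => N.
  rewrite partition_funE; congr (_ <= _); congr unif_mean; apply/funext => x.
  by rewrite JE.
- have [b2 b2max phi0] : exists2 b2, Num.max b b' < b2 &
      forall t, (forall k, 0 <= t k <= 1) -> hsbm_phi lambda Theta b2 t <= 0.
    by apply: (below_threshold p2); case: (lerP b b').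
  rewrite gt_max in b2max; case/andP: b2max => bb2 b'b2.
  (* two intermediate parameters: the first bounds both tilted means, the second
     leaves room for Young's inequality *)
  pose b1 := (Num.max b b' + b2) / 2; pose b3 := (b1 + b2) / 2.
  have m2 : Num.max b b' < b2 by rewrite gt_max bb2.
  have [mb mb'] : b <= Num.max b b' /\ b' <= Num.max b b' by rewrite !le_max !lexx orbT.
  have [C HC] := mean_field_bounded p2 lambda_prop Theta01 (beta := b3) (beta1 := b2)
    ltac:(rewrite /b3 /b1; lra) phi0.
  have UB : \forall N \near \oo, unif_mean (fun x => expR (b3 * `|U N x|)) <= C.
    by exists 1%N => // N /= N1; apply: HC.
  have b13 : 0 <= b1 < b3 by rewrite /b3 /b1; lra.
  have b1n : `|b1| = b1 by rewrite ger0_norm//; case/andP: b13.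
  have [D1 H1] := exp_mean_perturb b13 b1n WB UB.
  have [D2 H2] := exp_mean_perturb b13 (etrans (normrN _) b1n) WB UB.
  apply: (@no_consistent_estimator R p J b b' b1 (Num.max D1 D2)) => //.
  + by rewrite b0 /b1; lra.
  + by rewrite b'0 /b1; lra.
  apply: filterS2 H1 H2 => N h1 h2; rewrite !le_max; split.
    apply/orP; left; apply: le_trans h1; apply: unif_mean_le => x; by rewrite JE.
  apply/orP; right; apply: le_trans h2; apply: unif_mean_le => x; by rewrite JE.
Qed.
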